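(* Let $(X,d)$ be a compact perfect metric space and let $\{X;f_1,\dots,f_N\}$ be an iterated function system consisting of contractive infinitesimal similitudes $f_i:X\to X$ such that the mappings $x\mapsto (Df_i)(x)$ are strictly positive Hölder continuous functions on $X$. Assume moreover that there is a constant $C_2$ such that for all $w\in I^*$ and all $x\ne y$ in $X$, $$\frac{(Df_w)(x)}{C_2}\le \frac{d(f_w(x),f_w(y))}{d(x,y)}\le C_2\,(Df_w)(x).$$ Let $(p_1,\dots,p_N)$ be a probability vector and let $\mu$ be the unique Borel probability measure on $X$ with $\mu=\sum_{i=1}^N p_i\,\mu\circ f_i^{-1}$. Suppose that the IFS satisfies the strong open set condition. Then for every $0<r<+\infty$ the quantization dimension of order $r$ of $\mu$ is $D_r(\mu)=\sigma_r$, where $\sigma_r\ge 0$ is the unique number such that $\mathrm{spr}(L_{\sigma_r,r})=1$.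
   Context: Infinitesimal similitude: $f:X\to X$ is an infinitesimal similitude at $x\in X$ if for all sequences $(x_m),(y_m)$ in $X$ with $x_m\neq y_m$, $x_m\to x$, $y_m\to x$, the limit $(Df)(x):=\lim_{m\to\infty} \frac{d(f(x_m),f(y_m))}{d(x_m,y_m)}$ exists and is independent of the sequences; $f$ is an infinitesimal similitude on $X$ if this holds at every $x\in X$. Perfect means without isolated points. Contractive: $d(f_i(x),f_i(y))\le c_i d(x,y)$ for some $c_i<1$. Words: $I=\{1,\dots,N\}$, $I^*=\bigcup_{n\ge1}I^n$, and for $w=w_1\cdots w_n\in I^n$, $f_w=f_{w_1}\circ\cdots\circ f_{w_n}$. Attractor and strong open set condition (SOSC): $E\subset X$ is the unique nonempty compact set with $E=\bigcup_{i=1}^N f_i(E)$. The SOSC holds if there is a bounded nonempty open set $G\subset X$ with $\bigcup_{i=1}^N f_i(G)\subset G$, $f_i(G)\cap f_j(G)=\emptyset$ for $i\neq j$, and $E\cap G\neq\emptyset$. Operator: for $\sigma\ge 0$ and $0<r<\infty$, $L_{\sigma,r}:\mathcal C(X)\to\mathcal C(X)$ (real continuous functions with the sup norm) is $(L_{\sigma,r}\Phi)(x)=\sum_{i=1}^N\big(p_i (Df_i)(x)^r\big)^{\frac{\sigma}{r+\sigma}}\Phi(f_i(x))$, and $\mathrm{spr}$ denotes the spectral radius. Quantization dimension: $V_{n,r}(\mu)=\inf\{\int d(x,A)^r\,d\mu(x): A\subset X,\ \mathrm{Card}(A)\le n\}$ and $D_r(\mu)=\lim_{n\to\infty}\frac{r\log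 n}{-\log V_{n,r}(\mu)}$ if the limit exists.
   Formalization: The probability vector is required to have all p_i > 0; with zero weights the claim can fail, e.g. for p = (1,0) with two maps L_{0,r} has spectral radius 2 and L_{σ,r} has spectral radius below 1 for σ > 0, so no σ_r exists. *)

(* Defs.v *)
From HB Require Import structures.
From mathcomp Require Import all_boot all_order all_algebra.
From mathcomp Require Import complex.
From mathcomp Require Import all_classical all_reals all_analysis.

Set Implicit Arguments.
Unset Strict Implicit.
Unset Printing Implicit Defensive.

Import Order.TTheory GRing.Theory Num.Theory.
Import numFieldNormedType.Exports.

Local Open Scope classical_set_scope.
Local Open Scope ring_scope.

(* Measurable types of the library are pointed, hence so is a metric space
   that carries a Borel measure. *)
#[short(type="pointedMetricType")]
HB.structure Definition PointedMetric (R : numDomainType) :=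
  {T of Pointed T & Metric R T}.

Section InfinitesimalSimilitude.
Context {R : realType} {X : metricType R}.
Implicit Types (f : X -> X) (x : X) (l : R).

Definition is_sim_deriv f x l :=
  forall u v : nat -> X, (forall m, u m != v m) ->
    u @ \oo --> x -> v @ \oo --> x ->
    (fun m => mdist (f (u m)) (f (v m)) / mdist (u m) (v m)) @ \oo --> l.

(* One limit [l] serves all pairs of sequences: this is both the existence of
   the limits and their independence of the sequences. *)
Definition inf_similitude f := forall x, exists l, is_sim_deriv f x l.

(* [l] is unique when [x] is not isolated; the value is 0 when no [l] exists. *)
Definition simD f x : R := xget 0 [set l | is_sim_deriv f x l].

Definition contractive f :=
  exists2 c : R, c < 1 & forall x y, mdist (f x) (f y) <= c * mdist x y.

Definition hoelder_continuous (h : X -> R) :=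
  exists a C : R, 0 < a /\ forall x y, `|h x - h y| <= C * mdist x y `^ a.

End InfinitesimalSimilitude.

Section IFS.
Context {R : realType} {X : metricType R} {N : nat}.
Variable f : 'I_N -> X -> X.

Definition ifs_word (w : seq 'I_N) : X -> X :=
  foldr (fun i g => f i \o g) idfun w.

Definition is_attractor (E : set X) :=
  [/\ E !=set0, compact E & E = \bigcup_(i in [set: 'I_N]) (f i @` E)].

Definition metric_bounded (A : set X) :=
  exists M : R, forall x y, A x -> A y -> mdist x y <= M.

Definition strong_open_set_condition (E : set X) :=
  exists G : set X,
    [/\ metric_bounded G, open G & G !=set0] /\
    [/\ \bigcup_(i in [set: 'I_N]) (f i @` G) `<=` G,
        forall i j, i != j -> (f i @` G) `&` (f j @` G) = set0
      & E `&` G !=set0].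

Definition transfer_op (p : 'I_N -> R) (sigma r : R) (Phi : X -> R) : X -> R :=
  fun x => \sum_(i < N)
    (p i * simD (f i) x `^ r) `^ (sigma / (r + sigma)) * Phi (f i x).

End IFS.

(* Spectral radius of a bounded linear operator [T] on the real Banach space
   C(X), X compact: the spectrum is that of the complexification of [T], which
   acts on C(X, C) = C(X) + i C(X).  [T] is given on all functions X -> R, but
   only its values on continuous functions matter. *)
Section SpectralRadius.
Context {R : realType} {X : topologicalType}.
Implicit Types (T : (X -> R) -> X -> R) (z : R[i]).

Definition complexCX : set (X -> R[i]) :=
  [set Phi | continuous (fun x => complex.Re (Phi x)) /\
             continuous (fun x => complex.Im (Phi x))].

Definition complexify T (Phi : X -> R[i]) : X -> R[i] :=
  fun x => Complex (T (fun y => complex.Re (Phi y)) x)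
                   (T (fun y => complex.Im (Phi y)) x).

(* By the bounded inverse theorem, bijectivity of [z - T] on the Banach space
   C(X, C) is its invertibility as a bounded operator. *)
Definition spectrum T : set R[i] :=
  [set z | ~ set_bij complexCX complexCX
               (fun (Phi : X -> R[i]) x => z * Phi x - complexify T Phi x)].

Definition spectral_radius T : \bar R :=
  ereal_sup [set (ComplexField.Normc.normc z)%:E | z in spectrum T].

End SpectralRadius.

Notation borel X := (g_sigma_algebraType (@open X)).

Section Quantization.
Context {R : realType} {X : pointedMetricType R}.
Variable r : R.
Local Open Scope ereal_scope.

(* +oo when A is empty *)
Definition dist_to (A : set X) (x : X) : \bar R :=
  ereal_inf [set (mdist x a)%:E | a in A].

Definition quantization_error (mu : probability (borel X) R) (n : nat) : \bar R :=
  ereal_inf [set \int[mu]_x (dist_to A x `^ r) | A in [set A | (A #<= `I_n)%card]].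

(* Extended-real logarithm and quotient: [- lne 0 = +oo], so that the quotient
   is 0 where the error vanishes. *)
Definition has_quantization_dim (mu : probability (borel X) R) (D : R) :=
  (fun n : nat => (r * ln n%:R)%:E / - lne (quantization_error mu n))
    @ \oo --> D%:E.

End Quantization.

Definition self_similar_measure {R : realType} {X : pointedMetricType R} {N : nat}
    (f : 'I_N -> X -> X) (p : 'I_N -> R) (mu : probability (borel X) R) :=
  forall A : set (borel X), measurable A ->
    (mu A = \sum_(i < N) (p i)%:E * mu (f i @^-1` A))%E.

(* Main.v *)
(** For a word w let D_w be the derivative of f_w, which is the product of the
    derivatives of its letters, and put q_w = p_w D_w(x0)^r at a base point x0.
    Bounded distortion makes Z_n(t), the sum of q_w^t over |w| = n, sub- and
    supermultiplicative up to a constant, so ln Z_n(t) = n P(t) + O(1) for a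
    pressure P, which is strictly decreasing with P(0) >= 0 > P(1).

    Since L_{s,r}^n 1 is comparable to Z_n(s / (r + s)), its spectral radius is
    exp P(s / (r + s)): outside the disc of that radius the Neumann series
    converges, and at the radius itself the constant 1 is not in the range.  No
    eigenfunction is needed.

    For the quantization error, both bounds are inductions over the number of
    points that use words of one fixed length only.  If P(t) < 0, the points are
    allotted to the cylinders f_w(X) in proportion to q_w^t, which gives
    V_n = O(n^(-(1-t)/t)).  If P(t) > 0, the open set condition gives a suffix u
    for which the sets f_{vu}(X), |v| = k, are disjoint and compact; for the error
    truncated at a small radius the points near distinct such sets do not
    interact, and Jensen's inequality for x^(-(1-t)/t) gives the matching lower
    bound.  Letting t tend to the zero of P identifies the limit. *)

From HB Require Import structures.
Require Import Defs.
From mathcomp Require Import all_boot all_order all_algebra.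
From mathcomp Require Import complex.
From mathcomp Require Import all_classical all_reals all_analysis.
From mathcomp Require Import measurable_realfun.
From mathcomp Require Import ring lra.

Set Implicit Arguments.
Unset Strict Implicit.
Unset Printing Implicit Defensive.

Import Order.TTheory GRing.Theory Num.Theory.
Import numFieldNormedType.Exports.
Local Open Scope classical_set_scope.
Local Open Scope ring_scope.

(** * Growth rates and roots of real functions *)

(** The tangent line at 1 of the convex function x^(-a), obtained from exp u >= 1 + u and ln x <= x
    - 1. *)
Lemma powR_bernoulli_neg (R : realType) (x a : R) :
  0 < x -> 0 <= a -> 1 + a - a * x <= x `^ (- a).
Proof.
move=> x0 a0; rewrite /powR gt_eqF//.
have lnx : ln x <= x - 1.
  have := expR_ge1Dx (ln x); rewrite lnK ?posrE// => h; lra.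
have := expR_ge1Dx (- a * ln x).
have : a * ln x <= a * (x - 1) by rewrite ler_wpM2l.
lra.
Qed.

Lemma le0_of_natmul_bounded (R : realType) (h c : R) :
  (forall n : nat, n%:R * h <= c) -> h <= 0.
Proof.
move=> hc; rewrite leNgt; apply/negP => h0.
have [n] : exists n : nat, c / h < n%:R.
  by exists (Num.truncn (c / h)).+1; exact: truncnS_gt.
by rewrite ltr_pdivrMr// ltNge hc.
Qed.

(** Iterating the hypothesis puts a(mn) within (n + 1)c of n a(m) and, by symmetry, within (m + 1)c
    of m a(n). Hence a(m)/m and a(n)/n differ by at most 2c/m + 2c/n, and a common slope exists. *)
Lemma quasimorphism_slope (R : realType) (a : nat -> R) (c : R) :
  (forall m n, `|a (m + n)%N - a m - a n| <= c) ->
  exists L, forall n, `|a n - n%:R * L| <= 2 * c.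
Proof.
move=> ac.
have c0 : 0 <= c by exact: le_trans (ac 0 0)%N.
have a0 : `|a 0%N| <= c.
  by have := ac 0%N 0%N; rewrite addn0 subrr sub0r normrN.
have am m n : `|a (m * n)%N - n%:R * a m| <= (n%:R + 1) * c.
  elim: n => [|n IH]; first by rewrite muln0 mul0r subr0 add0r mul1r.
  have := ac m (m * n)%N; rewrite mulnS => h.
  have -> : a (m + m * n)%N - n.+1%:R * a m =
      (a (m + m * n)%N - a m - a (m * n)%N) + (a (m * n)%N - n%:R * a m).
    by rewrite -[n.+1]addn1 natrD; ring.
  by rewrite (le_trans (ler_normD _ _))// -[n.+1]addn1 natrD; lra.
pose A := [set x : R | exists n, (0 < n)%N /\ x = (a n - 2 * c) / n%:R].
(* The intervals of radius 2c/n around a(n)/n meet pairwise, so the supremum of their left ends lies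
   in all of them. *)
have key m n : (0 < m)%N -> (0 < n)%N ->
    (a m - 2 * c) / m%:R <= (a n + 2 * c) / n%:R.
  move=> m0 n0; rewrite ler_pdivrMr ?ltr0n// mulrAC ler_pdivlMr ?ltr0n//.
  have := am m n; have := am n m; rewrite mulnC !ler_norml => /andP[h1 h2].
  move=> /andP[h3 h4].
  have : 1 <= m%:R :> R by rewrite ler1n.
  have : 1 <= n%:R :> R by rewrite ler1n.
  nra.
have A1 : has_sup A.
  split; first by exists ((a 1%N - 2 * c) / 1%:R); exists 1%N.
  by exists ((a 1%N + 2 * c) / 1%:R) => x [n [n0 ->]]; exact: key.
exists (sup A) => n; have [->|n0] := posnP n; first by rewrite mul0r subr0; lra.
have h1 : (a n - 2 * c) / n%:R <= sup A.
  by apply: ub_le_sup; [case: A1|exists n].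
have h2 : sup A <= (a n + 2 * c) / n%:R.
  by apply: ge_sup; [case: A1|move=> _ [m [m0 ->]]; exact: key].
move: h1 h2; rewrite ler_pdivrMr ?ltr0n// ler_pdivlMr ?ltr0n//.
by rewrite ler_norml => h1 h2; apply/andP; split; lra.
Qed.

(** The root is the supremum of the points where P >= 0. The slope bound A stands in for continuity:
    if P t < 0, points of the set within -P t / A of t would have negative values; if P t > 0, the
    set would continue to the right of t. *)
Lemma bilipschitz_decreasing_root (R : realType) (P : R -> R) (A B : R) :
  0 < A -> 0 < B ->
  (forall s t, 0 <= s -> s <= t -> t <= 1 ->
     B * (t - s) <= P s - P t <= A * (t - s)) ->
  0 <= P 0 -> P 1 < 0 ->
  exists t, [/\ 0 <= t, t < 1 & P t = 0].
Proof.
move=> A0 B0 PAB P0 P1.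
pose S := [set s : R | 0 <= s <= 1 /\ 0 <= P s].
have S0 : S 0 by split=> //; rewrite lexx ler01.
have Sub : ubound S 1 by move=> s [/andP[]].
have hS : has_sup S by split; [exists 0|exists 1].
pose t := sup S.
have t0 : 0 <= t by apply: ub_le_sup => //; exists 1.
have t1 : t <= 1 by apply: ge_sup => //; exists 0.
have Pt0 : 0 <= P t.
  rewrite leNgt; apply/negP => Pt.
  have e0 : 0 < - P t / A by rewrite divr_gt0// oppr_gt0.
  have [s [/andP[s0 s1] Ps] ts] := sup_adherent e0 hS.
  have st : s <= t by apply: ub_le_sup; [exists 1|split=> //; apply/andP].
  have /andP[_] := PAB _ _ s0 st t1.
  have : A * (t - s) < - P t.
    by rewrite mulrC -ltr_pdivlMr//; move: ts; rewrite -/t; lra.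
  lra.
have t1' : t < 1.
  by rewrite lt_neqAle t1 andbT; apply/eqP => tE; move: Pt0; rewrite tE leNgt P1.
exists t; split=> //; apply/eqP; rewrite eq_le Pt0 andbT leNgt; apply/negP => Pt.
pose e := Num.min (1 - t) (P t / A).
have e0 : 0 < e by rewrite lt_min subr_gt0 t1' divr_gt0.
have e1 : t + e <= 1 by rewrite -lerBrDl ge_min lexx.
have /andP[_ h] := PAB t (t + e) t0 (ltac:(lra)) e1.
have eA : A * e <= P t by rewrite mulrC -ler_pdivlMr// ge_min lexx orbT.
have : S (t + e) by split; [apply/andP; split=> //; lra|lra].
move=> /(ub_le_sup (ex_intro _ 1 Sub)); rewrite -/t; lra.
Qed.

Lemma le0_of_geometric_bound (R : realType) (C q y : R) :
  0 <= q < 1 -> (forall n : nat, y <= C * q ^+ n) -> y <= 0.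
Proof.
move=> /andP[q0 q1] yC; rewrite leNgt; apply/negP => y0.
have /cvgrPdist_lt/(_ _ y0) : geometric C q @ \oo --> 0.
  by apply: cvg_geometric; rewrite ger0_norm.
move=> [n _ /(_ _ (leqnn n))]; rewrite /= sub0r normrN ltNge.
by rewrite (le_trans (yC n))// ler_norm.
Qed.

(** With d n the tail of the geometric series, u - d increases and u + d decreases, so the intervals
    of radius d n around u n are nested; the supremum of the left ends is the limit, with an
    explicit rate. *)
Lemma geometric_cauchy_limit (R : realType) (u : nat -> R) (C q : R) :
  0 <= q < 1 -> (forall n, `|u n.+1 - u n| <= C * q ^+ n) ->
  exists l, forall n, `|l - u n| <= C * q ^+ n / (1 - q).
Proof.
move=> /andP[q0 q1] uC.
have q1' : 0 < 1 - q by rewrite subr_gt0.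
have C0 : 0 <= C by have := le_trans (normr_ge0 _) (uC 0%N); rewrite expr0 mulr1.
pose d n := C * q ^+ n / (1 - q).
have dS n : d n.+1 = d n - C * q ^+ n.
  by rewrite /d exprS; field; rewrite gt_eqF.
have d0 n : 0 <= d n by rewrite /d divr_ge0 ?mulr_ge0 ?exprn_ge0// ltW.
have lo : {homo (fun n => u n - d n) : m n / (m <= n)%N >-> m <= n}.
  apply: homo_leq => [//|y x z|n]; first exact: le_trans.
  by have := uC n; rewrite ler_norml dS => /andP[? ?]; lra.
have hi : {homo (fun n => - (u n + d n)) : m n / (m <= n)%N >-> m <= n}.
  apply: homo_leq => [//|y x z|n]; first exact: le_trans.
  by have := uC n; rewrite ler_norml dS => /andP[? ?]; lra.
have lohi m n : u m - d m <= u n + d n.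
  have h1 := lo _ _ (leq_maxl m n); have h2 := hi _ _ (leq_maxr m n).
  by have := d0 (maxn m n); move: h1 h2 => /=; lra.
pose A := range (fun n => u n - d n).
have hA : has_sup A.
  split; first by exists (u 0%N - d 0%N); exists 0%N.
  by exists (u 0%N + d 0%N) => _ [m _ <-]; exact: lohi.
exists (sup A) => n; rewrite -/(d n).
have h1 : u n - d n <= sup A by apply: ub_le_sup; [case: hA|exists n].
have h2 : sup A <= u n + d n.
  by apply: ge_sup; [case: hA|move=> _ [m _ <-]; exact: lohi].
by rewrite ler_norml; apply/andP; split; lra.
Qed.

Lemma geometric_uniform_limit (R : realType) (X : topologicalType)
    (u : nat -> X -> R) (C q : R) :
  0 <= q < 1 -> (forall n, continuous (u n)) ->
  (forall n x, `|u n.+1 x - u n x| <= C * q ^+ n) ->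
  exists2 U : X -> R, continuous U &
    forall n x, `|U x - u n x| <= C / (1 - q) * q ^+ n.
Proof.
move=> q01 uc uC.
have [U UE] := choice (fun x => geometric_cauchy_limit q01 (fun n => uC n x)).
have UE' n x : `|U x - u n x| <= C / (1 - q) * q ^+ n.
  by rewrite mulrAC.
exists U => // x; apply/cvgrPdist_lt => e e0.
have [n Cn] : exists n, C / (1 - q) * q ^+ n < e / 3.
  apply: contrapT => /forallNP h.
  have : e / 3 <= 0.
    by apply: (le0_of_geometric_bound q01) => n; rewrite leNgt; exact/negP/(h n).
  lra.
have /cvgrPdist_lt/(_ (e / 3)) := uc n x.
move=> /(_ (ltac:(lra))); apply: filterS => y.
have := UE' n x; have := UE' n y; rewrite !ler_norml !ltr_norml.
by move=> /andP[? ?] /andP[? ?] /andP[? ?]; apply/andP; split; lra.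
Qed.

Lemma continuous_compact_bounded (R : realType) (X : topologicalType)
    (u : X -> R) :
  compact [set: X] -> continuous u -> exists2 M, 0 <= M & forall x, `|u x| <= M.
Proof.
move=> cX uc; have [[x0]|nX] := pselect (exists x : X, True); last first.
  by exists 0 => // x; case: nX; exists x.
have uc' : continuous (fun x => `|u x|).
  by move=> x; apply: (@continuous_comp _ _ _ u Num.norm); [exact: uc|exact: norm_continuous].
have [c _ h] := @compact_EVT_max X R (fun x => `|u x|) setT
  (ex_intro _ x0 I) cX (continuous_subspaceT uc').
by exists `|u c| => // x; apply: h; rewrite inE.
Qed.

(** * The spectral radius of a positive operator on C(X) *)

Lemma normc_le_normD (R : realType) (w : R[i]) :
  ComplexField.Normc.normc w <= `|complex.Re w| + `|complex.Im w|.
Proof.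
case: w => a b /=; rewrite -[leRHS]ger0_norm ?addr_ge0// -sqrtr_sqr.
rewrite ler_sqrt ?sqr_ge0// sqrrD !real_normK ?num_real//.
by rewrite lerD2r lerDl mulrn_wge0// mulr_ge0.
Qed.

Lemma normRe_le_normc (R : realType) (w : R[i]) :
  `|complex.Re w| <= ComplexField.Normc.normc w.
Proof.
case: w => a b /=; rewrite -sqrtr_sqr ler_sqrt ?addr_ge0 ?sqr_ge0//.
by rewrite lerDl sqr_ge0.
Qed.

Lemma normIm_le_normc (R : realType) (w : R[i]) :
  `|complex.Im w| <= ComplexField.Normc.normc w.
Proof.
case: w => a b /=; rewrite -sqrtr_sqr ler_sqrt ?addr_ge0 ?sqr_ge0//.
by rewrite lerDr sqr_ge0.
Qed.

Lemma ReM (R : realType) (z w : R[i]) : complex.Re (z * w) =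
  complex.Re z * complex.Re w - complex.Im z * complex.Im w.
Proof. by case: z w => [a b] [c d]. Qed.

Lemma ImM (R : realType) (z w : R[i]) : complex.Im (z * w) =
  complex.Re z * complex.Im w + complex.Im z * complex.Re w.
Proof. by case: z w => [a b] [c d]. Qed.

Lemma ReD (R : realType) (z w : R[i]) :
  complex.Re (z + w) = complex.Re z + complex.Re w.
Proof. by case: z w => [a b] [c d]. Qed.

Lemma ImD (R : realType) (z w : R[i]) :
  complex.Im (z + w) = complex.Im z + complex.Im w.
Proof. by case: z w => [a b] [c d]. Qed.

Lemma ReB (R : realType) (z w : R[i]) :
  complex.Re (z - w) = complex.Re z - complex.Re w.
Proof. by case: z w => [a b] [c d]. Qed.

Lemma ImB (R : realType) (z w : R[i]) :
  complex.Im (z - w) = complex.Im z - complex.Im w.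
Proof. by case: z w => [a b] [c d]. Qed.

Lemma complex_ext (R : realType) (z w : R[i]) :
  complex.Re z = complex.Re w -> complex.Im z = complex.Im w -> z = w.
Proof. by case: z w => [a b] [c d] /= -> ->. Qed.

Lemma continuous_lincomb (R : realType) (X : topologicalType) (a b : R)
    (u v : X -> R) :
  continuous u -> continuous v -> continuous (fun x => a * u x + b * v x).
Proof.
move=> cu cv x; apply: cvgD; apply: cvgM; try exact: cvg_cst.
- exact: cu.
- exact: cv.
Qed.

Section PositiveOperator.
Variables (R : realType) (X : topologicalType) (T : (X -> R) -> X -> R).
Hypothesis compactX : compact [set: X].
Variable x0 : X.
Hypothesis T_linear : forall (a b : R) (u v : X -> R),
  T (fun y => a * u y + b * v y) = fun x => a * T u x + b * T v x.
Hypothesis T_mono : forall u v : X -> R,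
  (forall y, u y <= v y) -> forall x, T u x <= T v x.
Hypothesis T_cont : forall u : X -> R, continuous u -> continuous (T u).
(** The two-sided growth of the orbit of the constant 1 is the only quantitative input; positivity
    carries the upper bound over to all bounded functions. *)
Variables rho K : R.
Hypothesis rho_gt0 : 0 < rho.
Hypothesis K_ge0 : 0 <= K.
Hypothesis T_ub : forall n x, iter n T (cst 1) x <= K * rho ^+ n.
Hypothesis T_lb : forall n x, rho ^+ n <= K * iter n T (cst 1) x.

Local Notation CT := (complexify T).
Local Notation normc := ComplexField.Normc.normc.

Lemma iter_linear n (a b : R) (u v : X -> R) :
  iter n T (fun y => a * u y + b * v y) =
  fun x => a * iter n T u x + b * iter n T v x.
Proof. by elim: n => [//|n IH]; rewrite iterS IH T_linear. Qed.

Lemma iter_mono n (u v : X -> R) :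
  (forall y, u y <= v y) -> forall x, iter n T u x <= iter n T v x.
Proof. by move=> uv; elim: n => [//|n IH] x; rewrite !iterS; exact: T_mono. Qed.

(** Positivity squeezes T^n u between -M T^n 1 and M T^n 1. *)
Lemma iter_bound n (u : X -> R) (M : R) : (forall y, `|u y| <= M) ->
  forall x, `|iter n T u x| <= M * K * rho ^+ n.
Proof.
move=> uM x; have M0 : 0 <= M by exact: le_trans (uM x0).
have TM (a : R) : iter n T (fun y => a * cst 1 y + 0 * cst 1 y) x =
    a * iter n T (cst 1) x by rewrite iter_linear mul0r addr0.
have hM : M * iter n T (cst 1) x <= M * K * rho ^+ n.
  by rewrite -mulrA ler_wpM2l.
have h1 : iter n T u x <= M * iter n T (cst 1) x.
  rewrite -TM; apply: iter_mono => y; rewrite mulr1 mul0r addr0.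
  by rewrite (le_trans (ler_norm _)).
have h2 : - M * iter n T (cst 1) x <= iter n T u x.
  rewrite -TM; apply: iter_mono => y; rewrite mulr1 mul0r addr0.
  by have := uM y; rewrite ler_norml => /andP[].
by rewrite ler_norml; apply/andP; split; lra.
Qed.

Lemma complexify_scale (z : R[i]) (F : X -> R[i]) :
  CT (fun y => z * F y) = fun x => z * CT F x.
Proof.
apply/funext => x; apply: complex_ext => /=.
  have -> : (fun y => complex.Re (z * F y)) =
    fun y => complex.Re z * complex.Re (F y) + (- complex.Im z) * complex.Im (F y).
    by apply/funext => y; rewrite ReM mulNr.
  by rewrite T_linear ReM mulNr.
have -> : (fun y => complex.Im (z * F y)) =
    fun y => complex.Re z * complex.Im (F y) + complex.Im z * complex.Re (F y).
  by apply/funext => y; rewrite ImM.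
by rewrite T_linear ImM.
Qed.

Lemma complexifyB (F G : X -> R[i]) :
  CT (fun y => F y - G y) = fun x => CT F x - CT G x.
Proof.
apply/funext => x; apply: complex_ext; rewrite ?ReB ?ImB /=.
  have -> : (fun y => complex.Re (F y - G y)) =
      fun y => 1 * complex.Re (F y) + (- 1) * complex.Re (G y).
    by apply/funext => y; rewrite ReB mul1r mulN1r.
  by rewrite T_linear mul1r mulN1r.
have -> : (fun y => complex.Im (F y - G y)) =
    fun y => 1 * complex.Im (F y) + (- 1) * complex.Im (G y).
  by apply/funext => y; rewrite ImB mul1r mulN1r.
by rewrite T_linear mul1r mulN1r.
Qed.

Lemma iter_complexify_bound (F : X -> R[i]) : complexCX F ->
  exists C, forall n x, normc (iter n CT F x) <= C * rho ^+ n.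
Proof.
move=> [cRe cIm].
have [M1 _ h1] := continuous_compact_bounded compactX cRe.
have [M2 _ h2] := continuous_compact_bounded compactX cIm.
exists (M1 * K + M2 * K) => n x.
have ReE : (fun y => complex.Re (iter n CT F y)) = iter n T (fun y => complex.Re (F y)).
  by elim: n => [//|n IH]; rewrite !iterS -IH.
have ImE : (fun y => complex.Im (iter n CT F y)) = iter n T (fun y => complex.Im (F y)).
  by elim: n {ReE} => [//|n IH]; rewrite !iterS -IH.
rewrite (le_trans (normc_le_normD _))// mulrDl.
rewrite (congr1 (fun f => f x) ReE) (congr1 (fun f => f x) ImE).
by rewrite lerD// iter_bound.
Qed.

Lemma complexCX_complexify (F : X -> R[i]) : complexCX F -> complexCX (CT F).
Proof. by move=> [? ?]; split=> /=; exact: T_cont. Qed.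

Lemma complexCX_scale (z : R[i]) (F : X -> R[i]) : complexCX F ->
  complexCX (fun x => z * F x).
Proof.
move=> [cRe cIm]; split.
  have -> : (fun x => complex.Re (z * F x)) = (fun x =>
      complex.Re z * complex.Re (F x) + (- complex.Im z) * complex.Im (F x)).
    by apply/funext => x; rewrite ReM mulNr.
  exact: continuous_lincomb.
have -> : (fun x => complex.Im (z * F x)) = (fun x =>
    complex.Re z * complex.Im (F x) + complex.Im z * complex.Re (F x)).
  by apply/funext => x; rewrite ImM.
exact: continuous_lincomb.
Qed.

Lemma complexCXD (F G : X -> R[i]) : complexCX F -> complexCX G ->
  complexCX (fun x => F x + G x).
Proof.
move=> [F1 F2] [G1 G2]; split.
  have -> : (fun x => complex.Re (F x + G x)) =
      (fun x => 1 * complex.Re (F x) + 1 * complex.Re (G x)).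
    by apply/funext => x; rewrite ReD !mul1r.
  exact: continuous_lincomb.
have -> : (fun x => complex.Im (F x + G x)) =
    (fun x => 1 * complex.Im (F x) + 1 * complex.Im (G x)).
  by apply/funext => x; rewrite ImD !mul1r.
exact: continuous_lincomb.
Qed.

Lemma complexCXB (F G : X -> R[i]) : complexCX F -> complexCX G ->
  complexCX (fun x => F x - G x).
Proof.
move=> cF cG; have -> : (fun x => F x - G x) = (fun x => F x + (-1) * G x).
  by apply/funext => x; rewrite mulN1r.
by apply: complexCXD => //; exact: complexCX_scale.
Qed.

(** A kernel element D satisfies T^n D = z^n D, while T^n D is O(rho^n) with rho < |z|, so D = 0.
    For surjectivity the Neumann series is summed, its limit being taken on real and imaginary parts
    separately. *)
Lemma resolvent_bijective (z : R[i]) : rho < normc z ->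
  set_bij complexCX complexCX (fun (F : X -> R[i]) x => z * F x - CT F x).
Proof.
move=> rhoz.
have z0 : 0 < normc z by exact: lt_trans rhoz.
have zn0 : z != 0 by apply: contraTneq z0 => ->; rewrite ComplexField.Normc.normc0 ltxx.
pose q := rho / normc z.
have q01 : 0 <= q < 1.
  by rewrite divr_ge0 ?(ltW rho_gt0) ?(ltW z0)//= ltr_pdivrMr// mul1r.
have normcX n : normc (z ^+ n) = normc z ^+ n.
  elim: n => [|n IH]; first by rewrite !expr0 ComplexField.Normc.normc1.
  by rewrite !exprS ComplexField.Normc.normcM IH.
have from_powers C n (w : R[i]) :
    normc (z ^+ n * w) <= C * rho ^+ n -> normc w <= C * q ^+ n.
  rewrite ComplexField.Normc.normcM normcX expr_div_n mulrA.
  by rewrite ler_pdivlMr ?exprn_gt0// mulrC.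
have normc_eq0 (w : R[i]) : normc w <= 0 -> w = 0.
  move=> h; apply: ComplexField.Normc.eq0_normc; apply/eqP.
  by rewrite eq_le h (le_trans _ (normRe_le_normc w)).
split.
- by move=> F cF; apply: complexCXB; [exact: complexCX_scale|exact: complexCX_complexify].
- move=> F G; rewrite !inE => cF cG FG.
  pose D x := F x - G x.
  have cD : complexCX D by exact: complexCXB.
  have DE : CT D = fun x => z * D x.
    rewrite complexifyB; apply/funext => x; rewrite /D mulrBr.
    have /(congr1 (fun f => f x)) /= := FG.
    move=> e; have -> : CT F x = z * F x - (z * F x - CT F x) by rewrite subKr.
    by rewrite e opprB addrA addrAC addrK.
  have itD n : (fun x => z ^+ n * D x) = iter n CT D.
    elim: n => [|n IH]; first by apply/funext => x; rewrite expr0 mul1r.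
    rewrite iterS -IH complexify_scale DE; apply/funext => x.
    by rewrite exprSr -mulrA.
  have [C hC] := iter_complexify_bound cD.
  apply/funext => x; apply/eqP; rewrite -subr_eq0; apply/eqP.
  apply: normc_eq0; apply: (le0_of_geometric_bound (C := C) q01) => n.
  by apply: from_powers; rewrite (congr1 (fun f => f x) (itD n)).
- move=> F cF.
  (* Partial sums of the Neumann series, the sum of z^(-k-1) T^k F over k < n, generated as a
     fixed-point iteration from 0. Their increments satisfy z^n D_n = T^n D_0 and so decay like
     q^n. *)
  pose Psi n := iter n (fun G x => z^-1 * (F x + CT G x)) (fun=> 0).
  have PsiS n x : z * Psi n.+1 x = F x + CT (Psi n) x.
    by rewrite /Psi iterS mulrA divff// mul1r.
  have cPsi n : complexCX (Psi n).
    elim: n => [|n IH]; first by split=> /=; exact: cst_continuous.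
    apply: complexCX_scale; apply: complexCXD => //; exact: complexCX_complexify.
  pose D n x := Psi n.+1 x - Psi n x.
  have DS n x : z * D n.+1 x = CT (D n) x.
    by rewrite /D mulrBr !PsiS complexifyB opprD addrACA subrr add0r.
  have itD n : (fun x => z ^+ n * D n x) = iter n CT (D 0%N).
    elim: n => [|n IH]; first by apply/funext => x; rewrite expr0 mul1r.
    rewrite iterS -IH complexify_scale; apply/funext => x.
    by rewrite exprSr -mulrA DS.
  have [C hC] := iter_complexify_bound (complexCXB (cPsi 1%N) (cPsi 0%N)).
  have Dq n x : normc (D n x) <= C * q ^+ n.
    by apply: from_powers; rewrite (congr1 (fun f => f x) (itD n)).
  have [U cU UE] := @geometric_uniform_limit _ _
    (fun n x => complex.Re (Psi n x)) C q q01 (fun n => (cPsi n).1)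
    (fun n x => ltac:(rewrite -ReB; exact: le_trans (normRe_le_normc _) (Dq n x))).
  have [V cV VE] := @geometric_uniform_limit _ _
    (fun n x => complex.Im (Psi n x)) C q q01 (fun n => (cPsi n).2)
    (fun n x => ltac:(rewrite -ImB; exact: le_trans (normIm_le_normc _) (Dq n x))).
  set C' := C / (1 - q) in UE VE.
  exists (fun x => Complex (U x) (V x)); first by [].
  apply/funext => x; apply/eqP; rewrite -subr_eq0; apply/eqP; apply: normc_eq0.
  apply: (le0_of_geometric_bound (C := normc z * (2 * C' * q) + 2 * C' * K * rho) q01).
  move=> n; pose E m y := Complex (U y) (V y) - Psi m y.
  (* Subtracting the recursion for [Psi] writes the defect of the limit through the errors [E] at
     two consecutive steps. These are O(q^n), while the defect does not depend on n, so it
     vanishes. *)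
  have -> : z * Complex (U x) (V x) - CT (fun y => Complex (U y) (V y)) x - F x =
      z * E n.+1 x - CT (E n) x.
    have aux (a b c d : R[i]) : a - b - c = a - (c + d) - (b - d) by ring.
    by rewrite /E mulrBr PsiS complexifyB; exact: aux.
  have ReE m y : `|complex.Re (E m y)| <= C' * q ^+ m by rewrite ReB; exact: UE.
  have ImE m y : `|complex.Im (E m y)| <= C' * q ^+ m by rewrite ImB; exact: VE.
  have h1 : normc (E n.+1 x) <= 2 * C' * q * q ^+ n.
    rewrite (le_trans (normc_le_normD _))//.
    by have := ReE n.+1 x; have := ImE n.+1 x; rewrite exprS; lra.
  have h2 : normc (CT (E n) x) <= 2 * C' * K * rho * q ^+ n.
    rewrite (le_trans (normc_le_normD _))//=.
    have := iter_bound 1 (ReE n) x; have := iter_bound 1 (ImE n) x.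
    by rewrite /= expr1; lra.
  rewrite (le_trans (le_normcD _ _))// normcN.
  rewrite ComplexField.Normc.normcM mulrDl lerD//.
  by rewrite -[leRHS]mulrA ler_wpM2l// ltW.
Qed.

(* If rho u - T u = 1, then telescoping makes rho^n u - T^n u at least
   n rho^n / (K rho), while it is O(rho^n). *)
Lemma not_surjective_at_growth_rate :
  ~ set_bij complexCX complexCX
      (fun (F : X -> R[i]) x => Complex rho 0 * F x - CT F x).
Proof.
move=> [_ _ /(_ (fun=> Complex 1 0))[]].
  by split=> /=; exact: cst_continuous.
move=> F [cF _] FE; pose u y : R := complex.Re (F y).
have Tu : T u = fun x => rho * u x + (- 1) * cst 1 x.
  apply/funext => x; have := congr1 (fun f => complex.Re (f x)) FE.
  by rewrite ReB ReM /= mul0r subr0 -/u => e; rewrite mulr1 -/(u x); lra.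
have [M M0 uM] := continuous_compact_bounded compactX cF.
have itS n x : iter n.+1 T u x = rho * iter n T u x - iter n T (cst 1) x.
  by rewrite iterSr Tu iter_linear mulN1r.
have K0 : 0 < K.
  rewrite lt_neqAle K_ge0 andbT; apply/eqP => K0.
  by have := T_lb 0 x0; rewrite -K0 mul0r expr0 ler10.
have tele n : n%:R * (rho ^+ n / (K * rho)) <= rho ^+ n * u x0 - iter n T u x0.
  elim: n => [|n IH]; first by rewrite mul0r expr0 mul1r subrr.
  rewrite itS; have : rho ^+ n / K <= iter n T (cst 1) x0.
    by rewrite ler_pdivrMr// mulrC.
  have -> : n.+1%:R * (rho ^+ n.+1 / (K * rho)) =
      rho * (n%:R * (rho ^+ n / (K * rho))) + rho ^+ n / K.
    by rewrite exprS -[n.+1]addn1 natrD; field; rewrite !gt_eqF.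
  have : rho * (n%:R * (rho ^+ n / (K * rho))) <=
      rho * (rho ^+ n * u x0 - iter n T u x0) by rewrite ler_pM2l.
  move=> h1 h2; apply: (le_trans (lerD h1 h2)).
  by rewrite mulrBr exprS mulrA opprB addrA [leRHS]addrAC.
suff : (K * rho)^-1 <= 0 by apply/negP; rewrite -ltNge invr_gt0 mulr_gt0.
apply: (@le0_of_natmul_bounded _ _ (M + M * K)) => n.
have rn : 0 < rho ^+ n by rewrite exprn_gt0.
rewrite -(ler_pM2l rn) mulrCA (le_trans (tele n))//.
have := iter_bound n uM x0; rewrite ler_norml => /andP[h _].
have : rho ^+ n * u x0 <= rho ^+ n * M.
  by rewrite ler_pM2l// (le_trans (ler_norm _) (uM _)).
move=> h'; apply: (le_trans (lerB h' h)).
by rewrite mulrDr opprK [rho ^+ n * (M * K)]mulrC.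
Qed.

Lemma spectral_radius_growth_rate : spectral_radius T = rho%:E.
Proof.
apply/eqP; rewrite eq_le; apply/andP; split.
  apply: ge_ereal_sup => _ [z zT <-]; rewrite lee_fin leNgt; apply/negP => h.
  by apply: zT; exact: resolvent_bijective.
apply: ereal_sup_ubound; exists (Complex rho 0).
  exact: not_surjective_at_growth_rate.
by rewrite /= expr0n /= addr0 sqrtr_sqr ger0_norm// ltW.
Qed.

End PositiveOperator.

(** * Metric spaces and truncated distances *)

Section MetricContinuity.
Variables (R : realType) (X : metricType R).

Lemma metric_continuousP (Y : topologicalType) (u : Y -> X) (y : Y) :
  {for y, continuous u} <->
  forall e : R, 0 < e -> \forall z \near y, mdist (u y) (u z) < e.
Proof. exact: metricType_numDomainType.cvgrPdist_lt. Qed.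

Lemma near_mdist_lt (x : X) (e : R) : 0 < e -> \forall z \near x, mdist x z < e.
Proof.
move=> e0; have := nbhsx_ballx x e e0; apply: filterS => z.
by rewrite ballEmdist.
Qed.

Lemma hoelder_real_continuous (u : X -> R) : hoelder_continuous u -> continuous u.
Proof.
move=> [a [C [a0 uC]]] x; apply/cvgrPdist_lt => e e0.
pose d := (e / (`|C| + 1)) `^ a^-1.
have d0 : 0 < d by rewrite powR_gt0// divr_gt0// ltr_wpDl.
apply: filterS (near_mdist_lt x d0) => z xz; apply: le_lt_trans (uC x z) _.
have h : mdist x z `^ a < e / (`|C| + 1).
  have -> : e / (`|C| + 1) = d `^ a.
    by rewrite /d -powRrM mulVf ?gt_eqF// powRr1// divr_ge0 ?(ltW e0) ?addr_ge0.
  by rewrite gt0_ltr_powR// nnegrE ?mdist_ge0 ?ltW.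
have h' : `|C| * mdist x z `^ a <= `|C| * (e / (`|C| + 1)) by rewrite ler_wpM2l// ltW.
have h3 : C * mdist x z `^ a <= `|C| * mdist x z `^ a.
  by rewrite ler_wpM2r ?powR_ge0// ler_norm.
apply: (le_lt_trans h3); apply: (le_lt_trans h').
by rewrite mulrA ltr_pdivrMr ?ltr_wpDl// mulrC ltr_pM2l// ltrDl.
Qed.

Lemma lipschitz_real_continuous (u : X -> R) (L : R) :
  (forall x y, `|u x - u y| <= L * mdist x y) -> continuous u.
Proof.
move=> uL; apply: hoelder_real_continuous; exists 1, L; split=> // x y.
by rewrite powRr1 ?mdist_ge0.
Qed.

Lemma lipschitz_continuous_map (f : X -> X) (L : R) :
  (forall x y, mdist (f x) (f y) <= L * mdist x y) -> continuous f.
Proof.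
move=> fL x; apply/metric_continuousP => e e0.
have L0 : 0 < `|L| + 1 by rewrite ltr_wpDl.
have d0 : 0 < e / (`|L| + 1) by rewrite divr_gt0.
apply: filterS (near_mdist_lt x d0) => z; rewrite ltr_pdivlMr// => xz.
apply: le_lt_trans (fL x z) _; apply: le_lt_trans xz.
rewrite [leRHS]mulrC ler_wpM2r ?mdist_ge0//.
by rewrite (le_trans (ler_norm L))// lerDl.
Qed.

Lemma mdist_lipschitz (a x y : X) : `|mdist x a - mdist y a| <= mdist x y.
Proof.
rewrite ler_norml; apply/andP; split.
  by have := metric_triangle y x a; rewrite (metric_sym y x); lra.
by have := metric_triangle x y a; lra.
Qed.

Lemma mdist_continuous (a : X) : continuous (fun x => mdist x a).
Proof.
by apply: (@lipschitz_real_continuous _ 1) => x y; rewrite mul1r mdist_lipschitz.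
Qed.

Lemma compact_diameter : compact [set: X] ->
  exists2 D : R, 0 < D & forall x y : X, mdist x y <= D.
Proof.
move=> cX; have [[x0]|nX] := pselect (exists x : X, True); last first.
  by exists 1 => // x; case: nX; exists x.
have [M M0 hM] := continuous_compact_bounded cX (@mdist_continuous x0).
exists (2 * M + 1); first by lra.
move=> x y; have := metric_triangle x x0 y; rewrite (metric_sym x0 y).
have := hM x; have := hM y; rewrite !ger0_norm ?mdist_ge0//; lra.
Qed.

Lemma compact_nearest (f : X -> X) (a : X) : compact [set: X] -> continuous f ->
  exists b, forall y, mdist (f b) a <= mdist (f y) a.
Proof.
move=> cX cf.
have [b _ hb] := @compact_EVT_min X R (fun x => mdist (f x) a) setT
  (ex_intro _ a I) cX (continuous_subspaceT (fun x =>
     @continuous_comp _ _ _ f (fun y => mdist y a) x (cf x) (@mdist_continuous a (f x)))).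
by exists b => y; apply: hb; rewrite inE.
Qed.

(** The distance [h] to the compact image of f is 1-Lipschitz and attained, so its minimum over the
    image of g is attained too, at a point outside the image of f. *)
Lemma compact_images_separated (f g : X -> X) (x0 : X) : compact [set: X] ->
  continuous f -> continuous g -> (forall x y, f x != g y) ->
  exists2 e : R, 0 < e & forall x y, e <= mdist (f x) (g y).
Proof.
move=> cX cf cg fg.
have [nf nfE] := choice (fun a => compact_nearest a cX cf).
pose h a := mdist (f (nf a)) a.
have hc : continuous h.
  apply: (@lipschitz_real_continuous _ 1) => a b; rewrite mul1r /h ler_norml.
  apply/andP; split.
    have := nfE b (nf a); have := metric_triangle (f (nf a)) a b; lra.
  have := nfE a (nf b); have := metric_triangle (f (nf b)) b a.
  by rewrite (metric_sym b a); lra.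
have [b _ hb] := @compact_EVT_min X R (fun x => h (g x)) setT
  (ex_intro _ x0 I) cX (continuous_subspaceT (fun x =>
     @continuous_comp _ _ _ g h x (cg x) (hc (g x)))).
exists (h (g b)); first by rewrite mdist_gt0.
move=> x y; apply: le_trans (nfE (g y) x); apply: hb; rewrite inE//.
Qed.

(* The value is [tau] when [s] is empty, so that the error of no points is
   positive and finite: this starts the induction for the lower bound. *)
Definition tdist (tau : R) (s : seq X) (x : X) : R :=
  foldr (fun a m => Num.min (mdist x a) m) tau s.

Lemma le_tdist tau s c x :
  (c <= tdist tau s x) = (c <= tau) && all (fun a => c <= mdist x a) s.
Proof. by elim: s => [|a s IH] /=; rewrite ?andbT// le_min IH andbCA. Qed.

Lemma tdist_le_radius tau s x : tdist tau s x <= tau.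
Proof. by have := lexx (tdist tau s x); rewrite le_tdist => /andP[]. Qed.

Lemma tdist_le_mem tau s a x : a \in s -> tdist tau s x <= mdist x a.
Proof.
by have := lexx (tdist tau s x); rewrite le_tdist => /andP[_ /allP h] /h.
Qed.

Lemma tdist_ge0 tau s x : 0 <= tau -> 0 <= tdist tau s x.
Proof. by move=> t0; rewrite le_tdist t0; apply/allP => a _; exact: mdist_ge0. Qed.

Lemma tdist_continuous tau s : continuous (tdist tau s).
Proof.
apply: (@lipschitz_real_continuous _ 1) => x y; rewrite mul1r.
have half u v : tdist tau s u - mdist u v <= tdist tau s v.
  rewrite le_tdist; apply/andP; split.
    by have := tdist_le_radius tau s u; have := mdist_ge0 u v; lra.
  apply/allP => a /(tdist_le_mem tau u); have := metric_triangle u v a; lra.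
rewrite ler_norml; have := half x y; have := half y x; rewrite (metric_sym y x).
by move=> ? ?; apply/andP; split; lra.
Qed.

End MetricContinuity.

(** * Integrals against a self-similar measure *)

Section BorelIntegral.
Variables (R : realType) (X : pointedMetricType R).
Variable mu : probability (borel X) R.

Lemma continuous_borel_measurable (f : X -> X) :
  continuous f -> measurable_fun [set: borel X] (f : borel X -> borel X).
Proof.
move=> /continuousP cf.
apply: (@measurability _ _ (borel X) (borel X) setT f (@open X)) => //.
move=> _ [A oA <-]; rewrite setTI; apply: sub_sigma_algebra; exact: cf.
Qed.

Lemma continuous_real_measurable (u : X -> R) :
  continuous u -> measurable_fun [set: borel X] (u : borel X -> R).
Proof.
move=> /continuousP cu.
apply: (@measurability _ _ (borel X) _ setT u _ (RGenOpens.measurableE R)).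
move=> _ [_ [a [b ->] <-]]; rewrite setTI; apply: sub_sigma_algebra.
by apply: cu; exact: interval_open.
Qed.

(** The existential form lets [choice] select one bundled measure for each map of the system. *)
Lemma pushforward_measure_exists (g : X -> X) : continuous g ->
  exists m : {measure set (borel X) -> \bar R},
    (forall A, m A = mu (g @^-1` A)) /\
    forall phi : borel X -> \bar R, measurable_fun setT phi ->
      (forall x, (0 <= phi x)%E) ->
      (\int[m]_x phi x = \int[mu]_x phi (g x))%E.
Proof.
move=> cg; have mg := continuous_borel_measurable cg.
pose g' : {mfun (borel X) >-> (borel X)} :=
  HB.pack (g : borel X -> borel X) (isMeasurableFun.Build _ _ _ _ _ mg).
exists (distribution mu g'); split=> // phi mphi phi0.
by rewrite ge0_integral_pushforward// preimage_setT.
Qed.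

Variables (N : nat) (f : 'I_N -> X -> X) (p : 'I_N -> R).
Hypothesis f_cont : forall i, continuous (f i).
Hypothesis p_ge0 : forall i, 0 <= p i.
Hypothesis mu_selfsim : self_similar_measure f p mu.

Lemma self_similar_integral (phi : X -> R) :
  measurable_fun [set: borel X] (phi : borel X -> R) -> (forall x, 0 <= phi x) ->
  (\int[mu]_x (phi x)%:E = \sum_(i < N) (p i)%:E * \int[mu]_x (phi (f i x))%:E)%E.
Proof.
move=> mphi phi0.
have mphiE : measurable_fun [set: borel X] (fun x : borel X => (phi x)%:E).
  exact/measurable_EFinP.
have [m mE] := choice (fun i => pushforward_measure_exists (f_cont (i := i))).
(* [msum] runs over natural numbers, so the scaled pushforwards are extended by the zero measure
   outside the alphabet. *)
pose M (k : nat) : {measure set (borel X) -> \bar R} :=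
  if insub k is Some i then mscale (NngNum (p_ge0 i)) (m i) else mzero.
have MN : forall A, measurable A -> A `<=` [set: borel X] -> mu A = msum M N A.
  move=> A mA _; rewrite (mu_selfsim mA) /msum; apply: eq_bigr => i _.
  by rewrite /M valK /= /mscale /= (mE i).1.
rewrite (eq_measure_integral (msum M N))// ge0_integral_measure_sum//; last first.
  by move=> x _; rewrite lee_fin.
apply: eq_bigr => i _; rewrite /M valK ge0_integral_mscale//=; last first.
  by move=> x _; rewrite lee_fin.
by rewrite (mE i).2// => x; rewrite lee_fin.
Qed.

End BorelIntegral.

Lemma big_tuple_cons (R : nmodType) (T : finType) n (F : seq T -> R) :
  \sum_(w : n.+1.-tuple T) F w = \sum_(i : T) \sum_(w : n.-tuple T) F (i :: w).
Proof.
rewrite pair_big /= (reindex (fun q : T * n.-tuple T => cons_tuple q.1 q.2)) /=.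
  by apply: eq_bigr => -[i w] _.
exists (fun w => (thead w, behead_tuple w)) => [[i w]|w] _ /=.
  by rewrite theadE; congr (_, _); apply: val_inj.
by case/tupleP: w => i w; apply: val_inj; rewrite /= theadE.
Qed.

Lemma big_tuple_cat (R : nmodType) (T : finType) m n (F : seq T -> R) :
  \sum_(w : (m + n).-tuple T) F w =
  \sum_(v : m.-tuple T) \sum_(w : n.-tuple T) F (v ++ w).
Proof.
elim: m F => [|m IH] F.
  rewrite (big_pred1 [tuple]) /= => [|v]; last by rewrite [v]tuple0; exact/esym/eqP.
  by apply: eq_bigr => w _.
rewrite (@big_tuple_cons R T (m + n) F).
rewrite (@big_tuple_cons R T m (fun v => \sum_(w : n.-tuple T) F (v ++ w))).
apply: eq_bigr => i _; exact: (IH (fun w => F (i :: w))).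
Qed.

Section PowerIntegral.
Variables (R : realType) (X : pointedMetricType R).
Variable mu : probability (borel X) R.
Hypothesis compactX : compact [set: X].
Variable r : R.
Hypothesis r_gt0 : 0 < r.

(** Real-valued on purpose: continuous nonnegative functions on a compact space have finite
    integrals, so the estimates below can be carried out in [R]. *)
Definition power_integral (u : X -> R) : R :=
  \int[mu]_(x in [set: borel X]) (u x `^ r).

Lemma power_measurable (u : X -> R) : continuous u ->
  measurable_fun [set: borel X] (fun x : borel X => u x `^ r).
Proof.
move=> cu; apply: (measurableT_comp (measurable_powR r)).
exact: continuous_real_measurable.
Qed.

Lemma power_integrable (u : X -> R) : continuous u -> (forall x, 0 <= u x) ->
  mu.-integrable [set: borel X] (EFin \o (fun x : borel X => u x `^ r)).
Proof.
move=> cu u0; apply: measurable_bounded_integrable => //.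
- by rewrite [X in (X < _)%E]probability_setT ltry.
- exact: power_measurable.
have [M M0 uM] := continuous_compact_bounded compactX cu.
exists (M `^ r); split; first exact: num_real.
move=> y My x _ /=; rewrite ger0_norm ?powR_ge0//; apply: le_trans (ltW My).
rewrite ge0_ler_powR ?nnegrE ?(ltW r_gt0)//.
by rewrite (le_trans (ler_norm _)).
Qed.

Lemma power_integralE (u : X -> R) : continuous u -> (forall x, 0 <= u x) ->
  (power_integral u)%:E = (\int[mu]_x (u x `^ r)%:E)%E.
Proof.
move=> cu u0; rewrite /power_integral /Rintegral fineK//.
by apply: integrable_fin_num => //; exact: power_integrable.
Qed.

Lemma power_integral_ge0 (u : X -> R) : 0 <= power_integral u.
Proof. by apply: Rintegral_ge0 => x _; exact: powR_ge0. Qed.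

Lemma power_integral_le (u v : X -> R) : continuous u -> continuous v ->
  (forall x, 0 <= u x <= v x) -> power_integral u <= power_integral v.
Proof.
move=> cu cv uv.
have u0 x : 0 <= u x by case/andP: (uv x).
have v0 x : 0 <= v x by case/andP: (uv x) => h; exact: le_trans.
apply: le_Rintegral => //; try exact: power_integrable; try exact: measurableT.
move=> x _; rewrite ge0_ler_powR ?nnegrE ?(ltW r_gt0)//.
by case/andP: (uv x).
Qed.

Lemma power_integralZ (c : R) (u : X -> R) : 0 <= c -> continuous u ->
  (forall x, 0 <= u x) ->
  power_integral (fun x => c * u x) = c `^ r * power_integral u.
Proof.
move=> c0 cu u0; rewrite /power_integral -RintegralZl//; last first.
  exact: power_integrable.
by congr Rintegral; apply/funext => x; rewrite powRM.
Qed.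

Lemma power_integral_cst (c : R) : power_integral (fun=> c) = c `^ r.
Proof.
rewrite /power_integral Rintegral_cst//.
by rewrite [X in fine X]probability_setT mulr1.
Qed.

Variables (N : nat) (f : 'I_N -> X -> X) (p : 'I_N -> R).
Hypothesis f_cont : forall i, continuous (f i).
Hypothesis p_ge0 : forall i, 0 <= p i.
Hypothesis mu_selfsim : self_similar_measure f p mu.

Lemma ifs_word_continuous w : continuous (ifs_word f w).
Proof.
elim: w => [|i w IH] x; first exact: cvg_id.
by apply: (continuous_comp (IH x)); exact: f_cont.
Qed.

Lemma power_integral_self_similar (u : X -> R) : continuous u ->
  (forall x, 0 <= u x) ->
  power_integral u = \sum_(i < N) p i * power_integral (u \o f i).
Proof.
move=> cu u0; have cuf i : continuous (u \o f i).
  by move=> x; apply: continuous_comp; [exact: f_cont|exact: cu].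
apply: EFin_inj; rewrite power_integralE// -sumEFin.
rewrite (self_similar_integral f_cont p_ge0 mu_selfsim (power_measurable cu)); last first.
  by move=> x; exact: powR_ge0.
by apply: eq_bigr => i _; rewrite EFinM power_integralE// => x; exact: u0.
Qed.

Lemma power_integral_words k (u : X -> R) : continuous u ->
  (forall x, 0 <= u x) ->
  power_integral u =
  \sum_(w : k.-tuple 'I_N) (\prod_(i <- w) p i) * power_integral (u \o ifs_word f w).
Proof.
elim: k u => [|k IH] u cu u0.
  rewrite (big_pred1 [tuple]) /= => [|v]; last by rewrite [v]tuple0; exact/esym/eqP.
  by rewrite big_nil mul1r.
rewrite (@big_tuple_cons _ _ k (fun w =>
  (\prod_(i <- w) p i) * power_integral (u \o ifs_word f w))).
rewrite power_integral_self_similar//; apply: eq_bigr => i _.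
rewrite IH; last by move=> x; exact: u0.
  by rewrite mulr_sumr; apply: eq_bigr => w _; rewrite big_cons mulrA.
by move=> x; apply: continuous_comp; [exact: f_cont|exact: cu].
Qed.

End PowerIntegral.

(** * Allocation of points to finitely many pieces *)

(* The convex function x^(-(1-t)/t) lies above its tangent at 1; take
   x = n / (m a^t). *)
Lemma allocation_tangent (R : realType) (t a n m : R) : 0 < t < 1 ->
  0 < a -> 0 < n -> 0 < m ->
  m `^ (- ((1 - t) / t)) *
    ((1 + (1 - t) / t) * a `^ t - (1 - t) / t * (n / m)) <=
  a * n `^ (- ((1 - t) / t)).
Proof.
move=> /andP[t0 t1] a0 n0 m0; set al := (1 - t) / t.
have al0 : 0 <= al by rewrite divr_ge0 ?subr_ge0 ?ltW.
have th0 : 0 < a `^ t by exact: powR_gt0.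
have x0 : 0 < n / (m * a `^ t) by rewrite divr_gt0// mulr_gt0.
have := powR_bernoulli_neg x0 al0.
rewrite -(ler_pM2l (mulr_gt0 (powR_gt0 (- al) m0) th0)).
have -> : m `^ (- al) * a `^ t * (n / (m * a `^ t)) `^ (- al) = a * n `^ (- al).
  rewrite powRM ?invr_ge0 ?mulr_ge0 ?ltW// -powR_inv1 ?mulr_ge0 ?ltW//.
  rewrite -powRrM mulN1r opprK powRM ?ltW// -powRrM.
  have {3}-> : a = a `^ t * a `^ (t * al).
    rewrite -powRD; last by rewrite (gt_eqF a0) implybT.
    rewrite -[LHS]powRr1 ?ltW//; congr (_ `^ _).
    by rewrite /al; field; rewrite gt_eqF.
  rewrite (powRN m); move: (powR_gt0 al m0); move: (m `^ al) => M M0.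
  by field; rewrite gt_eqF.
apply: le_trans; rewrite le_eqVlt; apply/orP; left; apply/eqP.
by field; rewrite !gt_eqF.
Qed.

(** Induction on the number m of points. A piece that receives no point already contributes enough
    error. Otherwise every piece has fewer than m points, and the tangent inequalities add up to the
    claim because the a^t sum to at least 1 and the sizes to at most m. *)
Lemma allocation_lower_bound (R : realType) (Y : Type) (T : finType)
    (En : seq Y -> R) (a : T -> R) (t e0 : R) :
  0 < t < 1 -> (1 < #|T|)%N -> 0 < e0 -> (forall v, 0 < a v) ->
  1 <= \sum_v a v `^ t ->
  (forall s, 0 <= En s) -> e0 <= En [::] ->
  (forall s, exists S : T -> seq Y, (\sum_v size (S v) <= size s)%N /\
     \sum_v a v * En (S v) <= En s) ->
  exists2 b, 0 < b & forall (n : nat) s, (0 < n)%N -> (size s <= n)%N ->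
    b * n%:R `^ (- ((1 - t) / t)) <= En s.
Proof.
move=> t01 T1 e00 a0 at1 En0 Enil split_s.
have /andP[t0 t1] := t01.
set al := (1 - t) / t; have al0 : 0 <= al by rewrite divr_ge0 ?subr_ge0 ?ltW.
have pow_le1 (n : nat) : (0 < n)%N -> (n%:R : R) `^ (- al) <= 1.
  move=> n0; rewrite powRN invf_le1 ?powR_gt0 ?ltr0n//.
  by rewrite -[leLHS](powRr0 n%:R) ler_powR// ler1n.
(* The minimum over the pieces makes b <= e0 a(v), which settles an empty piece; the cap at 1 makes
   b <= e0, which settles the empty sequence. *)
pose b := e0 * \big[Num.min/1]_v a v.
have b0 : 0 < b by rewrite mulr_gt0// lt_bigmin ?ltr01//= => v _; exact: a0.
have bav v : b <= e0 * a v by rewrite ler_pM2l// bigmin_le_cond.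
have be0 : b <= e0 by rewrite -[leRHS]mulr1 ler_pM2l// bigmin_le_id.
have main m : forall s, size s = m -> (0 < m)%N -> b * m%:R `^ (- al) <= En s.
  elim/ltn_ind: m => m IH s sm m0.
  have [S [Ssz SE]] := split_s s; apply: le_trans SE.
  have [/existsP[v /eqP Sv0]|/existsPn Sn0] := boolP [exists v, size (S v) == 0%N].
    rewrite (bigD1 v)//= (size0nil Sv0).
    have h : b * m%:R `^ (- al) <= b by rewrite ler_piMr ?(ltW b0)// pow_le1.
    have : e0 * a v <= a v * En [::] by rewrite mulrC ler_pM2l.
    have : 0 <= \sum_(i | i != v) a i * En (S i).
      by apply: sumr_ge0 => i _; rewrite mulr_ge0// ltW.
    by have := bav v; lra.
  have Spos v : (0 < size (S v))%N by rewrite lt0n Sn0.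
  (* At least two pieces, none of them empty, so each is strictly smaller than the whole. *)
  have Slt v : (size (S v) < m)%N.
    have [u uv] : exists u : T, u != v.
      move: T1; rewrite (cardD1 v) inE /= ltnS => /card_gt0P[u].
      by rewrite !inE => /andP[? _]; exists u.
    rewrite -sm; apply: leq_trans Ssz; rewrite (bigD1 v)//= (bigD1 u)//=.
    by rewrite -[X in (X < _)%N]addn0 ltn_add2l ltn_addr.
  have m0' : 0 < m%:R :> R by rewrite ltr0n.
  apply: (@le_trans _ _ (\sum_v b * (m%:R `^ (- al) *
      ((1 + al) * a v `^ t - al * ((size (S v))%:R / m%:R))))).
    rewrite -mulr_sumr ler_pM2l// -mulr_sumr -[leLHS]mulr1.
    rewrite ler_pM2l ?powR_gt0// big_split/= sumrN -!mulr_sumr -mulr_suml.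
    have h1 : (1 + al) * 1 <= (1 + al) * \sum_v a v `^ t.
      by rewrite ler_wpM2l// addr_ge0.
    have h2 : (\sum_v (size (S v))%:R) / m%:R <= 1 :> R.
      by rewrite ler_pdivrMr// mul1r -natr_sum ler_nat -sm.
    have : al * ((\sum_v (size (S v))%:R) / m%:R) <= al * 1 by rewrite ler_wpM2l.
    by lra.
  apply: ler_sum => v _.
  have h := IH _ (Slt v) (S v) erefl (Spos v).
  have h2 : a v * (b * (size (S v))%:R `^ (- al)) <= a v * En (S v) by rewrite ler_pM2l.
  apply: le_trans h2; rewrite [leRHS]mulrCA ler_pM2l//.
  by apply: allocation_tangent => //; rewrite ltr0n.
exists b => // n s n0 sn.
have [/size0nil ->|s0] := posnP (size s).
  rewrite (le_trans _ Enil)// (le_trans _ be0)//.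
  by rewrite ler_piMr ?(ltW b0)// pow_le1.
apply: le_trans (main _ s erefl s0); rewrite ler_pM2l// !powRN.
rewrite lef_pV2 ?posrE ?powR_gt0 ?ltr0n//.
by rewrite ge0_ler_powR// ?nnegrE ?ler0n// ler_nat.
Qed.

(** [Q n y] is to be read as: n points achieve error at most y. Induction on n, giving the piece v
    about n a(v)^t points; its error is then at most B n^(-(1-t)/t) a(v)^t, and these shares sum to
    at most half of the target. *)
Lemma allocation_upper_bound (R : realType) (T : finType)
    (Q : nat -> R -> Prop) (a : T -> R) (t D : R) :
  0 < t < 1 -> 0 <= D -> (forall v, 0 < a v) ->
  \sum_v a v `^ t <= 2^-1 ->
  Q 1%N D ->
  (forall m n x y, (m <= n)%N -> x <= y -> Q m x -> Q n y) ->
  (forall (n : T -> nat) (y : T -> R), (forall v, Q (n v) (y v)) ->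
     Q (\sum_v n v)%N (\sum_v a v * y v)) ->
  exists2 B, 0 < B & forall n : nat, (0 < n)%N ->
    Q n (B * n%:R `^ (- ((1 - t) / t))).
Proof.
move=> t01 D0 a0 at2 Q1 Qmono Qsplit.
have /andP[t0 t1] := t01.
set al := (1 - t) / t; have al0 : 0 <= al by rewrite divr_ge0 ?subr_ge0 ?ltW.
(* Rounding up costs at most one point per piece. For n > n0 the half of n left over by the bound
   1/2 pays for it, and each piece gets fewer than n points. *)
pose n0 := (2 * #|T| + 3)%N.
(* Large enough that a single point, with error D, settles all n <= n0; the summand 1 keeps B
   positive when D = 0. *)
pose B := (D + 1) * n0%:R `^ al.
have B0 : 0 < B by rewrite mulr_gt0 ?powR_gt0 ?ltr0n ?addn_gt0 ?orbT// ltr_wpDl.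
exists B => // n; elim/ltn_ind: n => n IH npos.
have npos' : 0 < n%:R :> R by rewrite ltr0n.
have [nn0|nn0] := leqP n n0.
  apply: Qmono Q1 => //; apply: (@le_trans _ _ (D + 1)); first by rewrite lerDl.
  rewrite -mulrA ler_peMr ?addr_ge0// powRN ler_pdivlMr ?powR_gt0// mul1r.
  by rewrite ge0_ler_powR// ?nnegrE ?ler0n// ler_nat.
pose k v := (Num.truncn (n%:R * a v `^ t)).+1.
have w0 v : 0 <= n%:R * a v `^ t by rewrite mulr_ge0 ?powR_ge0 ?ltW.
have klow v : n%:R * a v `^ t <= (k v)%:R by rewrite ltW// truncnS_gt.
have kup v : (k v)%:R <= n%:R * a v `^ t + 1.
  by rewrite /k -addn1 natrD lerD2r truncn_le.
have at_le v : a v `^ t <= 2^-1.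
  apply: le_trans at2; rewrite (bigD1 v)//= lerDl.
  by apply: sumr_ge0 => i _; exact: powR_ge0.
have n0R : 2 * #|T|%:R + 3 < n%:R :> R.
  by move: nn0; rewrite -(ltr_nat R) natrD natrM.
have T0 : 0 <= #|T|%:R :> R by [].
have kn v : (k v < n)%N.
  rewrite -(ltr_nat R); apply: le_lt_trans (kup v) _.
  have : n%:R * a v `^ t <= n%:R * 2^-1 by rewrite ler_pM2l.
  lra.
have ksum : (\sum_v k v <= n)%N.
  rewrite -(ler_nat R) natr_sum; apply: le_trans (ler_sum _ (fun v _ => kup v)) _.
  rewrite big_split/= sumr_const -mulr_sumr.
  have : n%:R * \sum_v a v `^ t <= n%:R * 2^-1 by rewrite ler_pM2l.
  rewrite -[X in _ + X]/(1 *+ _); lra.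
apply: (Qmono _ _ _ _ ksum _ (Qsplit k _ (fun v => IH (k v) (kn v) isT))).
have step v : a v * (B * (k v)%:R `^ (- al)) <= B * n%:R `^ (- al) * a v `^ t.
  have -> : B * n%:R `^ (- al) * a v `^ t = a v * (B * (n%:R * a v `^ t) `^ (- al)).
    rewrite powRM ?powR_ge0 ?ltW// -powRrM.
    have -> : a v `^ t = a v * a v `^ (t * - al).
      rewrite -[X in X * _]powRr1 ?(ltW (a0 v))// -powRD; last by rewrite (gt_eqF (a0 v)) implybT.
      by congr (_ `^ _); rewrite /al; field; rewrite gt_eqF.
    ring.
  rewrite ler_pM2l// ler_pM2l// !powRN lef_pV2 ?posrE ?powR_gt0//; last first.
    by rewrite mulr_gt0 ?powR_gt0.
  by rewrite ge0_ler_powR// ?nnegrE ?ler0n.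
apply: le_trans (ler_sum _ (fun v _ => step v)) _.
rewrite -mulr_sumr; apply: ler_piMr; last by apply: (le_trans at2); lra.
by apply: mulr_ge0; [exact: ltW|exact: powR_ge0].
Qed.

(** * Quantization bounds from one finite family of maps *)

Section FiniteFamily.
Variables (R : realType) (X : pointedMetricType R).
Variable mu : probability (borel X) R.
Hypothesis compactX : compact [set: X].
Variable r : R.
Hypothesis r_gt0 : 0 < r.
Variables (T : finType) (g : T -> X -> X) (P : T -> R).
Hypothesis g_cont : forall v, continuous (g v).
Hypothesis P_gt0 : forall v, 0 < P v.

Local Notation PI := (power_integral mu r).

(** Good point sets for the pieces are pushed forward by the g_v and united; distances shrink by the
    factor L_v, which feeds the allocation lemma with weights P_v L_v^r. *)
Lemma quantization_upper_bound (L : T -> R) (t D : R) :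
  0 < t < 1 -> (0 < #|T|)%N -> 0 < D -> (forall x y : X, mdist x y <= D) ->
  (forall v, 0 < L v) ->
  (forall v x y, mdist (g v x) (g v y) <= L v * mdist x y) ->
  (forall u : X -> R, continuous u -> (forall x, 0 <= u x) ->
     PI u <= \sum_v P v * PI (u \o g v)) ->
  \sum_v (P v * L v `^ r) `^ t <= 2^-1 ->
  exists2 B, 0 < B & forall n : nat, (0 < n)%N ->
    exists s, [/\ (0 < size s)%N, (size s <= n)%N &
      PI (tdist D s) <= B * n%:R `^ (- ((1 - t) / t))].
Proof.
move=> t01 /card_gt0P[v0 _] D0 diamD L0 gL PIs sumL.
pose Q n y := exists s, [/\ (0 < size s)%N, (size s <= n)%N & PI (tdist D s) <= y].
apply: (@allocation_upper_bound _ T Q (fun v => P v * L v `^ r) t (D `^ r)) => //.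
- exact: powR_ge0.
- by move=> v; rewrite mulr_gt0// powR_gt0.
- exists [:: point]; split=> //; rewrite -(power_integral_cst mu r D).
  apply: power_integral_le => //; first exact: tdist_continuous.
    exact: cst_continuous.
  by move=> x; rewrite tdist_le_radius tdist_ge0// ltW.
- move=> m n x y mn xy [s [s0 sm sx]]; exists s; split=> //.
    exact: leq_trans mn.
  exact: le_trans xy.
move=> n y /choice[S SE].
pose s := flatten [seq map (g v) (S v) | v <- enum T].
have mem_s v a : a \in S v -> g v a \in s.
  move=> aS; apply/flattenP; exists (map (g v) (S v)); last exact: map_f.
  by apply: map_f; rewrite mem_enum.
have pw v z : tdist D s (g v z) <= L v * tdist D (S v) z.
  have h a : a \in S v -> tdist D s (g v z) / L v <= mdist z a.
    move=> aS; rewrite ler_pdivrMr// mulrC; apply: le_trans (gL v z a).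
    exact/tdist_le_mem/mem_s.
  rewrite mulrC -ler_pdivrMr// le_tdist; apply/andP; split; last exact/allP.
  (* The cutoff D is dealt with by any point of the nonempty [S v], since all distances are at most
     D. *)
  have [+ _ _] := SE v; case: (S v) h => //= a l h _.
  by apply: le_trans (h a _) _; rewrite ?mem_head.
exists s; split.
- have [+ _ _] := SE v0; case E: (S v0) => [//|a l] _.
  rewrite -has_predT; apply/hasP; exists (g v0 a) => //.
  by apply: mem_s; rewrite E mem_head.
- rewrite /s size_flatten /shape -map_comp sumnE big_map big_enum /=.
  by apply: leq_sum => v _; rewrite size_map; have [] := SE v.
apply: le_trans (PIs _ (@tdist_continuous _ _ D s) _) _.
  by move=> x; rewrite tdist_ge0// ltW.
apply: ler_sum => v _; rewrite -mulrA ler_pM2l//.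
have [_ _ SEv] := SE v.
have : L v `^ r * PI (tdist D (S v)) <= L v `^ r * y v by rewrite ler_wpM2l// powR_ge0.
apply: le_trans.
rewrite -power_integralZ ?(ltW (L0 v))//; last 2 first.
- exact: tdist_continuous.
- by move=> x; rewrite tdist_ge0// ltW.
apply: power_integral_le => //.
- by move=> x; apply: continuous_comp; [exact: g_cont|exact: tdist_continuous].
- by move=> x; apply: cvgM; [exact: cvg_cst|exact: tdist_continuous].
by move=> x; rewrite pw andbT tdist_ge0// ltW.
Qed.

(** Below half the separation of the images g_v(X), a point can be close to at most one of them. A
    point set thus splits among the pieces, at the price of a factor 2 in the lower Lipschitz
    constants. *)
Lemma quantization_lower_bound (l : T -> R) (t : R) :
  0 < t < 1 -> (1 < #|T|)%N ->
  (forall v, 0 < l v <= 1) ->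
  (forall v x y, l v * mdist x y <= mdist (g v x) (g v y)) ->
  (forall v w x y, v != w -> g v x != g w y) ->
  (forall u : X -> R, continuous u -> (forall x, 0 <= u x) ->
     \sum_v P v * PI (u \o g v) <= PI u) ->
  1 <= \sum_v (P v * (l v / 2) `^ r) `^ t ->
  exists d b, [/\ 0 < d, 0 < b & forall (n : nat) s, (0 < n)%N -> (size s <= n)%N ->
    b * n%:R `^ (- ((1 - t) / t)) <= PI (tdist d s)].
Proof.
move=> t01 T1 l01 gl gsep PIs suml.
(* Pairs with equal entries get the dummy value 1, so that a minimum over all pairs can be taken. *)
have sep (q : T * T) : exists e : R, 0 < e /\
    (q.1 != q.2 -> forall x y, e <= mdist (g q.1 x) (g q.2 y)).
  have [E|vw] := eqVneq q.1 q.2; first by exists 1.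
  have [c c0 cE] := compact_images_separated (point : X) compactX
    (g_cont (v := q.1)) (g_cont (v := q.2)) (fun x y => gsep q.1 q.2 x y vw).
  by exists c; split.
have [e eE] := choice sep.
pose d := (\big[Num.min/1]_q e q) / 2.
have d0 : 0 < d by rewrite divr_gt0// lt_bigmin ?ltr01//= => q _; case: (eE q).
have dsep v w x y : v != w -> 2 * d <= mdist (g v x) (g w y).
  move=> vw; rewrite mulrC divfK//.
  have [_ /(_ vw x y)] := eE (v, w); apply: le_trans.
  exact: bigmin_le_cond.
have [near_ nearE] := choice (fun va : T * X =>
  compact_nearest va.2 compactX (g_cont (v := va.1))).
pose close v a := mdist (g v (near_ (v, a))) a < d.
have close_uniq v w a : close v a -> close w a -> v = w.
  move=> va wa; apply/eqP; apply/negPn/negP => vw.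
  have := dsep v w (near_ (v, a)) (near_ (w, a)) vw.
  have := metric_triangle (g v (near_ (v, a))) a (g w (near_ (w, a))).
  by move: va wa; rewrite /close (metric_sym (g w _)); lra.
have d2 v : 0 < l v / 2 by have /andP[? _] := l01 v; rewrite divr_gt0.
suff split_s s : exists S : T -> seq X, (\sum_v size (S v) <= size s)%N /\
    \sum_v P v * (l v / 2) `^ r * PI (tdist d (S v)) <= PI (tdist d s).
  have nil_le : d `^ r <= PI (tdist d [::]).
    by rewrite -[leLHS](power_integral_cst mu r d).
  have [b b0 bE] := allocation_lower_bound t01 T1 (powR_gt0 r d0)
    (fun v => mulr_gt0 (P_gt0 v) (powR_gt0 r (d2 v))) suml
    (fun s => power_integral_ge0 mu r (tdist d s)) nil_le split_s.
  by exists d, b.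
(* A point close to g_v(X) is moved to the nearest point of g_v(X), which at most
   doubles its distance to g_v(X), and then pulled back along g_v. *)
exists (fun v => [seq near_ (v, a) | a <- s & close v a]); split.
  elim: s => [|a s IH] /=; first by rewrite big1.
  have -> : (\sum_v size [seq near_ (v, a0) | a0 <- if close v a then
        a :: [seq x <- s | close v x] else [seq x <- s | close v x]] =
      \sum_v (close v a : nat) + \sum_v size [seq near_ (v, a0) | a0 <- s & close v a0])%N.
    by rewrite -big_split; apply: eq_bigr => v _; case: ifP.
  rewrite -[(size s).+1]add1n leq_add//.
  have [[v va]|/forallNP nv] := pselect (exists v, close v a); last first.
    by rewrite big1// => v _; case E: (close v a) => //; case: (nv v).
  rewrite (bigD1 v)//= big1 ?addn0 ?leq_b1// => w wv.
  case E: (close w a) => //.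
  by move: wv; rewrite (close_uniq _ _ _ va E) eqxx.
apply: le_trans (PIs _ (@tdist_continuous _ _ d s) _); last first.
  by move=> x; rewrite tdist_ge0// ltW.
apply: ler_sum => v _; rewrite -mulrA ler_pM2l//.
rewrite -power_integralZ ?(ltW (d2 v))//; last 2 first.
- exact: tdist_continuous.
- by move=> x; rewrite tdist_ge0// ltW.
apply: power_integral_le => //.
- by move=> x; apply: cvgM; [exact: cvg_cst|exact: tdist_continuous].
- by move=> x; apply: continuous_comp; [exact: g_cont|exact: tdist_continuous].
move=> y; rewrite mulr_ge0 ?(ltW (d2 v)) ?tdist_ge0 ?(ltW d0)//=.
set S := map _ _.
have S0 := tdist_ge0 S y (ltW d0); have Sd := tdist_le_radius d S y.
have /andP[l0 l1] := l01 v.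
have lS : l v / 2 * tdist d S y <= tdist d S y by rewrite ler_piMl//; lra.
rewrite le_tdist; apply/andP; split; first exact: le_trans Sd.
(* A point that is not close to g_v(X) stays at distance at least d from it, and the truncated
   distance never exceeds d. *)
apply/allP => a sa; have [ca|nca] := boolP (close v a); last first.
  have := nearE (v, a) y; move: nca; rewrite /close -leNgt /=; lra.
have Sa : near_ (v, a) \in S by apply: map_f; rewrite mem_filter ca.
have h1 := tdist_le_mem d y Sa.
have h2 := gl v y (near_ (v, a)).
have h3 := metric_triangle (g v y) a (g v (near_ (v, a))).
have h4 := nearE (v, a) y; rewrite /= in h4; rewrite (metric_sym a) in h3.
have : l v * tdist d S y <= l v * mdist y (near_ (v, a)) by rewrite ler_pM2l.
lra.
Qed.

End FiniteFamily.

(** * The quantization error and its logarithmic limit *)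

Lemma ln_nat_unbounded (R : realType) (M : R) :
  exists n0 : nat, forall n : nat, (n0 <= n)%N -> (0 < n)%N /\ M <= ln n%:R.
Proof.
exists (Num.truncn (expR M)).+1 => n nn0; have n0 := leq_trans (ltn0Sn _) nn0.
split=> //; rewrite -[leLHS]expRK ler_ln ?posrE ?expR_gt0 ?ltr0n//.
by rewrite (le_trans (ltW (truncnS_gt _)))// ler_nat.
Qed.

(** For a tolerance e the bounds are used at sg + e/2 and sg - e/2; the spare e/2 absorbs ln B and
    ln b once ln n is large. If sg <= e the lower estimate only says that the quotient is
    nonnegative. *)
Lemma log_ratio_cvg_of_power_bounds (R : realType) (V : nat -> \bar R) (r sg : R) :
  0 < r -> 0 <= sg -> (forall n, (0 <= V n)%E) ->
  (forall s, sg < s -> exists2 B, 0 < B & forall n, (0 < n)%N ->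
     (V n <= (B * n%:R `^ (- (r / s)))%:E)%E) ->
  (forall s, 0 < s -> s < sg -> exists2 b, 0 < b & forall n, (0 < n)%N ->
     ((b * n%:R `^ (- (r / s)))%:E <= V n)%E) ->
  ((fun n : nat => (r * ln n%:R)%:E / - lne (V n)) @ \oo --> sg%:E)%E.
Proof.
move=> r0 sg0 V0 Vup Vlow.
have lnM (B a n : R) : 0 < B -> 0 < n -> ln (B * n `^ (- a)) = ln B - a * ln n.
  by move=> B0 n0; rewrite lnM ?posrE ?powR_gt0// ln_powR mulNr.
have key e : 0 < e -> exists n0 : nat, forall n : nat, (n0 <= n)%N -> exists q,
    ((r * ln n%:R)%:E / - lne (V n) = q%:E)%E /\ `|sg - q| <= e.
  move=> e0; pose s1 := sg + e / 2; pose a1 := r / s1.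
  have s10 : 0 < s1 by rewrite /s1; lra.
  have a10 : 0 < a1 by rewrite divr_gt0.
  have [B B0 VB] : exists2 B, 0 < B & forall n, (0 < n)%N ->
      (V n <= (B * n%:R `^ (- a1))%:E)%E by apply: Vup; rewrite /s1; lra.
  have c10 : 0 < (sg + e) * a1 - r.
    rewrite subr_gt0 /a1 mulrA ltr_pdivlMr// mulrC ltr_pM2r//.
    by rewrite /s1; lra.
  have [b0 [b [b0_gt VbE]]] : exists n2 : nat, exists b : R, 0 < b /\
      (e < sg -> forall n : nat, (n2 <= n)%N -> (0 < n)%N /\
        exists a2, ((b * n%:R `^ (- a2))%:E <= V n)%E /\
          (sg - e) * (a2 * ln n%:R - ln b) <= r * ln n%:R).
    have [ge|ge] := leP sg e; first by exists 0%N, 1; split.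
    pose s2 := sg - e / 2; pose a2 := r / s2.
    have s20 : 0 < s2 by rewrite /s2; lra.
    have [b b0 Vb] : exists2 b, 0 < b & forall n, (0 < n)%N ->
        ((b * n%:R `^ (- a2))%:E <= V n)%E by apply: Vlow => //; rewrite /s2; lra.
    have c20 : 0 < r - (sg - e) * a2.
      rewrite subr_gt0 /a2 mulrA ltr_pdivrMr// mulrC ltr_pM2l//.
      by rewrite /s2; lra.
    have [n2 n2E] := ln_nat_unbounded (- ((sg - e) * ln b) / (r - (sg - e) * a2)).
    exists n2, b; split=> // _ n /n2E[n0 nE]; split=> //; exists a2; split; first exact: Vb.
    by move: nE; rewrite ler_pdivrMr//; lra.
  (* The first threshold absorbs ln B in the upper estimate; the second forces V n < 1, so that the
     denominator is positive. *)
  have [n1 n1E] := ln_nat_unbounded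
    (Num.max ((sg + e) * ln B / ((sg + e) * a1 - r)) ((ln B + 1) / a1)).
  exists (maxn 2 (maxn b0 n1)) => n; rewrite !geq_max => /and3P[n2 nb0 nn1].
  have [n0 ] := n1E n nn1; rewrite ge_max !ler_pdivrMr// => /andP[h1 h2].
  have n0R : 0 < n%:R :> R by rewrite ltr0n.
  have lnn : 0 < ln n%:R :> R by rewrite ln_gt0// ltr1n.
  have := VB n n0; have := V0 n.
  case VnE : (V n) => [v| |]//; rewrite !lee_fin => v0 vB.
  (* If the error vanishes, the quotient is 0 by the conventions for [lne] and the inverse; the
     lower power bound then rules out e < sg. *)
  have [v00|vn0] := eqVneq v 0.
    exists 0; rewrite v00 le0_lneNy//= invey mule0; split=> //.
    rewrite subr0 ger0_norm// leNgt; apply/negP => esg.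
    have [_ [a2 [h _]]] := VbE esg n nb0; move: h.
    by rewrite VnE v00 lee_fin leNgt mulr_gt0// powR_gt0.
  have v0' : 0 < v by rewrite lt_neqAle eq_sym vn0.
  have lnv : ln v <= ln B - a1 * ln n%:R.
    by rewrite -lnM// ler_ln ?posrE ?mulr_gt0 ?powR_gt0.
  have w0 : 0 < - ln v by rewrite oppr_gt0; apply: le_lt_trans lnv _; lra.
  exists (r * ln n%:R / - ln v); split.
    by rewrite lne_EFin// -EFinN inver gt_eqF.
  have up : r * ln n%:R / - ln v <= sg + e.
    rewrite ler_pdivrMr//.
    have : (sg + e) * (a1 * ln n%:R - ln B) <= (sg + e) * - ln v.
      by rewrite ler_pM2l; lra.
    lra.
  have low : sg - e <= r * ln n%:R / - ln v.
    have [ge|ge] := leP sg e.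
      apply: (@le_trans _ _ 0); first by rewrite subr_le0.
      by rewrite divr_ge0 ?mulr_ge0 ?(ltW r0) ?(ltW lnn) ?(ltW w0).
    have [_ [a2 [h ha]]] := VbE ge n nb0; move: h; rewrite VnE lee_fin => h.
    rewrite ler_pdivlMr//; apply: le_trans ha.
    have : ln b - a2 * ln n%:R <= ln v.
      by rewrite -lnM// ler_ln ?posrE ?mulr_gt0 ?powR_gt0.
    by move=> h'; rewrite ler_pM2l; lra.
  by rewrite ler_norml; apply/andP; split; lra.
apply/fine_cvgP; split.
  have [n0 n0E] := key 1 ltr01.
  by exists n0 => // n /= /n0E[q [-> _]].
apply/cvgrPdist_le => e /key[n0 n0E].
by exists n0 => // n /= /n0E[q [-> ]].
Qed.

Section QuantizationError.
Variables (R : realType) (X : pointedMetricType R).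
Variable mu : probability (borel X) R.
Hypothesis compactX : compact [set: X].
Variable r : R.
Hypothesis r_gt0 : 0 < r.
Variable D : R.
Hypothesis D_gt0 : 0 < D.
Hypothesis diamD : forall x y : X, mdist x y <= D.

(** With the diameter as cutoff, truncation is invisible as soon as there is a point. *)
Lemma dist_to_seqE (s : seq X) x : (0 < size s)%N ->
  dist_to [set` s] x = (tdist D s x)%:E.
Proof.
move=> s0; apply/eqP; rewrite eq_le; apply/andP; split; last first.
  apply: le_ereal_inf_tmp => _ [a /= sa <-]; rewrite lee_fin.
  exact: tdist_le_mem.
have lb a : a \in s -> (dist_to [set` s] x <= (mdist x a)%:E)%E.
  by move=> sa; apply: ereal_inf_lbound; exists a.
have fin : (dist_to [set` s] x <= D%:E)%E.
  case: s s0 lb => //= a s _ lb; apply: le_trans (lb a (mem_head _ _)) _.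
  by rewrite lee_fin.
have ge0 : (0 <= dist_to [set` s] x)%E.
  by apply: le_ereal_inf_tmp => _ [a _ <-]; rewrite lee_fin mdist_ge0.
case E : (dist_to [set` s] x) fin ge0 => [c| |]// fin ge0.
rewrite lee_fin le_tdist; apply/andP; split; first by rewrite -lee_fin.
by apply/allP => a /lb; rewrite E lee_fin.
Qed.

Lemma quantization_integral_seq (s : seq X) : (0 < size s)%N ->
  (\int[mu]_x (dist_to [set` s] x `^ r) = (power_integral mu r (tdist D s))%:E)%E.
Proof.
move=> s0; rewrite power_integralE//; last 2 first.
- exact: tdist_continuous.
- by move=> x; rewrite tdist_ge0// ltW.
by apply: eq_integral => x _; rewrite dist_to_seqE// poweR_EFin.
Qed.

Lemma quantization_error_ge0 n : (0 <= quantization_error r mu n)%E.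
Proof.
apply: le_ereal_inf_tmp => _ [A _ <-]; apply: integral_ge0 => x _.
exact: poweR_ge0.
Qed.

Lemma quantization_error_le n s y : (0 < size s)%N -> (size s <= n)%N ->
  power_integral mu r (tdist D s) <= y -> (quantization_error r mu n <= y%:E)%E.
Proof.
move=> s0 sn sy; apply: (@le_trans _ _ (power_integral mu r (tdist D s))%:E); last first.
  by rewrite lee_fin.
apply: ereal_inf_lbound; exists [set` s]; last exact: quantization_integral_seq.
apply: (card_le_trans (B := `I_(size s))); last by rewrite card_le_II.
have -> : [set` s] = nth point s @` `I_(size s).
  apply/seteqP; split=> [a /= sa|_ [i /= si <-]]; last exact: mem_nth.
  by exists (index a s); rewrite /= ?index_mem ?nth_index.
exact: card_image_le.
Qed.

(** Lowering the cutoff can only lower the error of a nonempty set, and the empty competitor has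
    error +oo. *)
Lemma quantization_error_ge n d y :
  (forall s, (size s <= n)%N -> y <= power_integral mu r (tdist d s)) -> 0 < d ->
  (y%:E <= quantization_error r mu n)%E.
Proof.
move=> hy d0; apply: le_ereal_inf_tmp => _ [A An <-].
have [s [sA sn]] : exists s : seq X, A = [set` s] /\ (size s <= n)%N.
  have finA : finite_set A by apply: (card_le_finite An); exact: finite_II.
  exists (finmap.enum_fset (fset_set A)); split; last exact: geq_card_fset_set.
  by rewrite -[LHS](fset_setK finA).
have [s0|s0] := posnP (size s).
  rewrite sA (size0nil s0).
  have dE (x : X) : (dist_to [set` [::]] x `^ r)%E = +oo%E.
    have E0 : [set (mdist x a)%:E | a in [set` Nil X]] = set0.
      by rewrite -subset0 => z [a /=]; rewrite in_nil.
    by rewrite /dist_to E0 ereal_inf0 poweRyr// gt_eqF.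
  rewrite (eq_integral (cst +oo%E)) => [|x _]; last exact: dE.
  by rewrite integral_cst ?[X in (_ * X)%E]probability_setT ?mule1 ?leey.
rewrite sA quantization_integral_seq// lee_fin; apply: le_trans (hy s sn) _.
apply: power_integral_le => //; try exact: tdist_continuous.
move=> x; rewrite tdist_ge0 ?(ltW d0)//= le_tdist; apply/andP; split.
  case: s s0 {sA sn} => // a s _; apply: le_trans (diamD x a).
  by apply: tdist_le_mem; rewrite mem_head.
by apply/allP => a; exact: tdist_le_mem.
Qed.
End QuantizationError.

(** * Infinitesimal similitudes and iterated function systems *)

Section SimilitudeDerivative.
Variables (R : realType) (X : pointedMetricType R).
Hypothesis perfectX : perfect_set [set: X].

Lemma perfect_approx (x : X) (e : R) : 0 < e -> exists2 y, y != x & mdist x y < e.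
Proof.
move=> e0; case: perfectX => _ /seteqP[_ /(_ x I)] /(_ _ (near_mdist_lt x e0)).
by move=> [y [yx _ ?]]; exists y.
Qed.

(** As x is not isolated, a sequence of points different from x tends to x; paired with the constant
    sequence x, it evaluates both limits. *)
Lemma sim_deriv_unique (f : X -> X) x (l1 l2 : R) :
  is_sim_deriv f x l1 -> is_sim_deriv f x l2 -> l1 = l2.
Proof.
move=> h1 h2.
have app (n : nat) : exists y, y != x /\ mdist x y < n.+1%:R^-1.
  have [y yx xy] := @perfect_approx x n.+1%:R^-1 (ltac:(by rewrite invr_gt0 ltr0n)).
  by exists y.
have [v vE] := choice app.
have cv : v @ \oo --> x.
  apply/metricType_numDomainType.cvgrPdist_lt => e e0.
  near=> n; apply: lt_trans (vE n).2 _; near: n.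
  exact: near_infty_natSinv_lt (PosNum e0).
have cc : (fun _ : nat => x) @ \oo --> x by exact: cvg_cst.
have vx n : x != v n by rewrite eq_sym; exact: (vE n).1.
exact: (cvg_unique _ (h1 _ _ vx cc cv) (h2 _ _ vx cc cv)).
Unshelve. all: by end_near. Qed.

Lemma simD_eq (f : X -> X) x (l : R) : is_sim_deriv f x l -> simD f x = l.
Proof.
move=> h; exact: sim_deriv_unique (xgetPex 0 (ex_intro _ l h)) h.
Qed.

Lemma simDP (f : X -> X) x : inf_similitude f -> is_sim_deriv f x (simD f x).
Proof. by move=> /(_ x)[l h]; rewrite (simD_eq h). Qed.

(** Injectivity of g keeps the image sequences apart, so that the difference quotient factors. *)
Lemma is_sim_deriv_comp (f g : X -> X) x (l m : R) :
  continuous g -> injective g ->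
  is_sim_deriv f (g x) l -> is_sim_deriv g x m -> is_sim_deriv (f \o g) x (l * m).
Proof.
move=> cg gi hf hg u v uv ux vx.
have -> : (fun n => mdist ((f \o g) (u n)) ((f \o g) (v n)) / mdist (u n) (v n)) =
    (fun n => mdist (f (g (u n))) (f (g (v n))) / mdist (g (u n)) (g (v n)) *
      (mdist (g (u n)) (g (v n)) / mdist (u n) (v n))).
  apply/funext => n; rewrite mulrA divfK//.
  by rewrite gt_eqF// mdist_gt0; apply: contra (uv n) => /eqP/gi ->.
apply: cvgM; last exact: hg.
apply: hf => [n||]; first by apply: contra (uv n) => /eqP/gi ->.
- by apply: (cvg_comp _ _ ux); exact: cg.
- by apply: (cvg_comp _ _ vx); exact: cg.
Qed.

End SimilitudeDerivative.

Lemma continuous_powR_pos (R : realType) (Y : topologicalType) (u : Y -> R) (a : R) :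
  continuous u -> (forall y, 0 < u y) -> continuous (fun y => u y `^ a).
Proof.
move=> cu u0.
have -> : (fun y => u y `^ a) = (fun y => expR (a * ln (u y))).
  by apply/funext => y; rewrite /powR gt_eqF.
move=> y; apply: (@continuous_comp _ _ _ (fun y => a * ln (u y)) expR); last first.
  exact: continuous_expR.
apply: cvgM; first exact: cvg_cst.
by apply: (@continuous_comp _ _ _ u (@ln R)); [exact: cu|exact: continuous_ln].
Qed.

Lemma continuous_sum (R : realType) (Y : topologicalType) (I : Type) (s : seq I)
    (F : I -> Y -> R) : (forall i, continuous (F i)) ->
  continuous (fun y => \sum_(i <- s) F i y).
Proof.
move=> cF; elim: s => [|i s IH].
  by under eq_fun do rewrite big_nil; exact: cst_continuous.
under eq_fun do rewrite big_cons.
by move=> y; apply: cvgD; [exact: cF|exact: IH].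
Qed.

Section IteratedFunctionSystem.
Variables (R : realType) (X : pointedMetricType R).
Hypothesis compactX : compact [set: X].
Hypothesis perfectX : perfect_set [set: X].
Variables (N : nat) (f : 'I_N -> X -> X).
Hypothesis f_contr : forall i, contractive (f i).
Hypothesis f_sim : forall i, inf_similitude (f i).
Hypothesis f_pos : forall i x, 0 < simD (f i) x.
Hypothesis f_hoelder : forall i, hoelder_continuous (simD (f i)).
Variable C2 : R.
Hypothesis C2_gt0 : 0 < C2.
Hypothesis f_dist : forall w : seq 'I_N, w != [::] -> forall x y : X, x != y ->
  simD (ifs_word f w) x / C2
    <= mdist (ifs_word f w x) (ifs_word f w y) / mdist x y
    <= C2 * simD (ifs_word f w) x.
Variable p : 'I_N -> R.
Hypothesis p_gt0 : forall i, 0 < p i.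
Hypothesis p_sum1 : \sum_(i < N) p i = 1.
Variable r : R.
Hypothesis r_gt0 : 0 < r.

Local Notation fw := (ifs_word f).
Local Notation x0 := (point : X).

(** * Derivatives of words and bounded distortion *)

Lemma ifs_continuous i : continuous (f i).
Proof. by have [c _ fc] := f_contr i; exact: lipschitz_continuous_map fc. Qed.

Lemma ifs_word_cat v w x : fw (v ++ w) x = fw v (fw w x).
Proof. by elim: v => //= i v ->. Qed.

Lemma ifs_injective i : injective (f i).
Proof.
move=> x y fxy; apply/eqP; apply/negPn/negP => xy.
have /andP[h _] := @f_dist [:: i] isT x y xy; move: h.
by rewrite /= fxy mdistxx mul0r leNgt divr_gt0// f_pos.
Qed.

Lemma ifs_word_injective w : injective (fw w).
Proof. by elim: w => [//|i w IH] x y /= /ifs_injective/IH. Qed.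

Fixpoint word_deriv (w : seq 'I_N) (x : X) : R :=
  if w is i :: w' then simD (f i) (fw w' x) * word_deriv w' x else 1.

Lemma word_deriv_gt0 w x : 0 < word_deriv w x.
Proof. by elim: w => //= i w IH; rewrite mulr_gt0. Qed.

Lemma word_deriv_cat v w x :
  word_deriv (v ++ w) x = word_deriv v (fw w x) * word_deriv w x.
Proof. by elim: v => [|i v IH] /=; rewrite ?mul1r// IH ifs_word_cat mulrA. Qed.

Lemma simD_ifs_word w x : simD (fw w) x = word_deriv w x.
Proof.
apply: (simD_eq perfectX); elim: w x => [|i w IH] x /=.
  move=> u v uv _ _.
  suff h : (fun m => mdist (u m) (v m) / mdist (u m) (v m)) @ \oo --> (1 : R) by [].
  have -> : (fun m => mdist (u m) (v m) / mdist (u m) (v m)) = cst (1 : R).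
    by apply/funext => m; rewrite divff// gt_eqF// mdist_gt0.
  exact: cvg_cst.
apply: is_sim_deriv_comp (IH x); last exact: (simDP perfectX).
  exact: (ifs_word_continuous ifs_continuous).
exact: ifs_word_injective.
Qed.

Lemma ifs_alphabet : exists i : 'I_N, True.
Proof.
case: N p p_sum1 => [q|n q _]; last by exists ord0.
by rewrite big_ord0 => /eqP; rewrite eq_sym oner_eq0.
Qed.

(** The two sides of the distance estimate at one pair of distinct points give 1 <= C2^2. This
    extends the estimate to the empty word below. *)
Lemma C2_ge1 : 1 <= C2.
Proof.
have [i _] := ifs_alphabet; have [y yx _] := perfect_approx perfectX x0 (@ltr01 R).
have /andP[h1 h2] := @f_dist [:: i] isT y x0 yx.
have := le_trans h1 h2; have h := f_pos i y.
rewrite ler_pdivrMr// -mulrA mulrCA ler_pMr//= => h3.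
have : 1 <= C2 ^+ 2 by rewrite expr2.
by rewrite expr_ge1// ltW.
Qed.

Lemma ifs_word_dist_le w x y :
  mdist (fw w x) (fw w y) <= C2 * word_deriv w x * mdist x y.
Proof.
have [<-|xy] := eqVneq x y; first by rewrite !mdistxx mulr0.
have [->|w0] := eqVneq w [::].
  by rewrite /= mulr1 ler_peMl ?mdist_ge0// C2_ge1.
have /andP[_] := f_dist w0 xy.
by rewrite simD_ifs_word ler_pdivrMr// mdist_gt0.
Qed.

Lemma ifs_word_dist_ge w x y :
  word_deriv w x / C2 * mdist x y <= mdist (fw w x) (fw w y).
Proof.
have [<-|xy] := eqVneq x y; first by rewrite !mdistxx mulr0.
have [->|w0] := eqVneq w [::].
  by rewrite /= ler_piMl ?mdist_ge0// mul1r invf_le1// C2_ge1.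
have /andP[+ _] := f_dist w0 xy.
by rewrite simD_ifs_word ler_pdivlMr// mdist_gt0.
Qed.

(** The distance between f_w(x) and f_w(y) is estimated from below with the derivative at x and from
    above with the derivative at y. *)
Lemma word_deriv_distortion w x y : word_deriv w x <= C2 ^+ 2 * word_deriv w y.
Proof.
have [<-|xy] := eqVneq x y.
  by rewrite ler_peMl ?(ltW (word_deriv_gt0 _ _))// exprn_ege1// C2_ge1.
have h1 := ifs_word_dist_ge w x y; have := ifs_word_dist_le w y x.
rewrite metric_sym (metric_sym y) => /(le_trans h1).
by rewrite ler_pM2r ?mdist_gt0// ler_pdivrMr// expr2 mulrAC.
Qed.

Lemma common_contraction : exists c, [/\ 0 < c, c < 1 &
  forall w x y, mdist (fw w x) (fw w y) <= c ^+ size w * mdist x y].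
Proof.
have fc i : exists c : R, c < 1 /\ forall x y, mdist (f i x) (f i y) <= c * mdist x y.
  by have [c] := f_contr i; exists c.
have [c cE] := choice fc.
(* The floor 1/2 makes the common ratio positive even if some contraction constant is not. *)
pose C := \big[Num.max/(2^-1)]_i c i.
have C0 : 0 < C by apply: lt_le_trans (bigmax_ge_id _ _ _ _); lra.
exists C; split=> //; first by apply: bigmax_lt => [|i _]; [lra|case: (cE i)].
elim=> [|i w IH] x y /=; first by rewrite expr0 mul1r.
apply: le_trans ((cE i).2 _ _) _; apply: (@le_trans _ _ (C * mdist (fw w x) (fw w y))).
  by rewrite ler_wpM2r ?mdist_ge0// le_bigmax_cond.
by rewrite exprS -mulrA ler_pM2l.
Qed.

(** From below, a letter has its derivative at the base point up to distortion, and finitely many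
    letters leave a positive minimum. From above, the lower distance estimate at a pair of distinct
    points is compared with contraction. *)
Lemma word_deriv_geometric : exists c m, [/\ 0 < c < 1, 0 < m < 1 &
  forall w x, m ^+ size w <= word_deriv w x <= C2 * c ^+ size w].
Proof.
have [c [c0 c1 cE]] := common_contraction.
pose m := \big[Num.min/(2^-1)]_i (simD (f i) x0 / C2 ^+ 2).
have m0 : 0 < m.
  by rewrite lt_bigmin ?invr_gt0 ?ltr0n//= => i _; rewrite divr_gt0 ?exprn_gt0.
have mE i x : m <= simD (f i) x.
  apply: le_trans (bigmin_le_cond _ _ (isT : xpredT i)) _.
  rewrite ler_pdivrMr ?exprn_gt0// mulrC.
  by have := word_deriv_distortion [:: i] x0 x; rewrite /= !mulr1.
exists c, m; split; first by rewrite c0.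
  by rewrite m0 (le_lt_trans (bigmin_le_id _ _ _ _))//; lra.
move=> w x; apply/andP; split.
  elim: w => [|i w IH] /=; first by rewrite expr0.
  by rewrite exprS ler_pM// ltW// exprn_gt0.
have [y yx _] := perfect_approx perfectX x (@ltr01 R); rewrite eq_sym in yx.
have := le_trans (ifs_word_dist_ge w x y) (cE w x y).
by rewrite ler_pM2r ?mdist_gt0// ler_pdivrMr// mulrC.
Qed.

(** * Word weights *)

Definition word_prob (w : seq 'I_N) : R := \prod_(i <- w) p i.

Lemma word_prob_gt0 w : 0 < word_prob w.
Proof. by apply: prodr_gt0 => i _. Qed.

Lemma ln_word_prob_le0 w : ln (word_prob w) <= 0.
Proof.
apply: ln_le0; elim: w => [|i w IH]; first by rewrite /word_prob big_nil.
rewrite /word_prob big_cons mulr_ile1 ?(ltW (p_gt0 i)) ?(ltW (word_prob_gt0 w))//.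
by rewrite -p_sum1 (bigD1 i)//= lerDl; apply: sumr_ge0 => j _; exact: ltW.
Qed.

Lemma sum_word_prob k : \sum_(w : k.-tuple 'I_N) word_prob w = 1.
Proof.
elim: k => [|k IH].
  rewrite (big_pred1 [tuple]) => [|v]; last by rewrite [v]tuple0; exact/esym/eqP.
  by rewrite /word_prob big_nil.
rewrite (@big_tuple_cons _ _ k word_prob) -[RHS]p_sum1; apply: eq_bigr => i _.
rewrite -[RHS]mulr1 -IH mulr_sumr; apply: eq_bigr => w _.
by rewrite /word_prob big_cons.
Qed.

Definition word_weight (x : X) (w : seq 'I_N) : R :=
  word_prob w * word_deriv w x `^ r.

Lemma word_weight_gt0 x w : 0 < word_weight x w.
Proof. by rewrite mulr_gt0 ?word_prob_gt0// powR_gt0// word_deriv_gt0. Qed.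

Lemma word_weight_cat x v w :
  word_weight x (v ++ w) = word_weight (fw w x) v * word_weight x w.
Proof.
rewrite /word_weight word_deriv_cat powRM ?(ltW (word_deriv_gt0 _ _))//.
by rewrite /word_prob big_cat /=; ring.
Qed.

(** The cost of moving the base point of a weight: the distortion constant of the derivative, raised
    to the power r. *)
Let kappa := (C2 ^+ 2) `^ r.

Lemma distortion_const_ge1 : 1 <= kappa.
Proof.
by rewrite -[leLHS](powRr0 (C2 ^+ 2)) ler_powR ?exprn_ege1 ?C2_ge1// ltW.
Qed.

Lemma word_weight_distortion x y w : word_weight x w <= kappa * word_weight y w.
Proof.
rewrite /word_weight /kappa mulrCA ler_pM2l ?word_prob_gt0//.
rewrite -powRM ?sqr_ge0 ?(ltW (word_deriv_gt0 _ _))//.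
apply: ge0_ler_powR; rewrite ?nnegrE ?(ltW r_gt0)//.
- exact/ltW/word_deriv_gt0.
- by rewrite mulr_ge0 ?sqr_ge0// ltW// word_deriv_gt0.
- exact: word_deriv_distortion.
Qed.

(** Since kappa >= 1, kappa^t <= kappa for t <= 1; a single constant thus serves all exponents. *)
Lemma word_weight_pow_distortion x y w t : 0 <= t <= 1 ->
  word_weight x w `^ t <= kappa * word_weight y w `^ t.
Proof.
move=> /andP[t0 t1]; have k1 := distortion_const_ge1.
have k0 : 0 <= kappa by exact: le_trans k1.
apply: (@le_trans _ _ ((kappa * word_weight y w) `^ t)).
  apply: ge0_ler_powR; rewrite ?nnegrE//.
  - exact/ltW/word_weight_gt0.
  - by rewrite mulr_ge0// ltW// word_weight_gt0.
  - exact: word_weight_distortion.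
rewrite powRM ?(ltW (word_weight_gt0 _ _))// ler_wpM2r ?powR_ge0//.
by rewrite ler1_powR.
Qed.

(** * Partition sums and the pressure *)

Definition partition_sum (t : R) (n : nat) : R :=
  \sum_(w : n.-tuple 'I_N) word_weight x0 w `^ t.

Lemma partition_sum_gt0 t n : 0 < partition_sum t n.
Proof.
have [i _] := ifs_alphabet.
rewrite /partition_sum (bigD1 [tuple of nseq n i])//= ltr_pwDl ?powR_gt0 ?word_weight_gt0//.
by apply: sumr_ge0 => w _; exact: powR_ge0.
Qed.

Lemma partition_sum_cat t m n : partition_sum t (m + n) =
  \sum_(v : m.-tuple 'I_N) \sum_(w : n.-tuple 'I_N)
    word_weight (fw w x0) v `^ t * word_weight x0 w `^ t.
Proof.
rewrite /partition_sum (big_tuple_cat _ _ (fun w => word_weight x0 w `^ t)).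
apply: eq_bigr => v _; apply: eq_bigr => w _.
by rewrite word_weight_cat powRM ?(ltW (word_weight_gt0 _ _)).
Qed.

Lemma partition_sum_prod t m n : partition_sum t m * partition_sum t n =
  \sum_(v : m.-tuple 'I_N) \sum_(w : n.-tuple 'I_N)
    word_weight x0 v `^ t * word_weight x0 w `^ t.
Proof. by rewrite /partition_sum mulr_suml; apply: eq_bigr => v _; rewrite mulr_sumr. Qed.

(** In a concatenation v w the weight of v is based at f_w(x0); moving it back to x0 costs kappa in
    either direction and separates the double sum into a product. *)
Lemma ln_partition_sum_quasimorphism t : 0 <= t <= 1 -> forall m n,
  `|ln (partition_sum t (m + n)) - ln (partition_sum t m) - ln (partition_sum t n)|
    <= ln kappa.
Proof.
move=> t01 m n; have k0 : 0 < kappa by apply: lt_le_trans distortion_const_ge1.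
have up : partition_sum t (m + n) <= kappa * (partition_sum t m * partition_sum t n).
  rewrite partition_sum_cat partition_sum_prod mulr_sumr; apply: ler_sum => v _.
  rewrite mulr_sumr; apply: ler_sum => w _; rewrite mulrA ler_wpM2r ?powR_ge0//.
  exact: word_weight_pow_distortion.
have low : partition_sum t m * partition_sum t n <= kappa * partition_sum t (m + n).
  rewrite partition_sum_cat partition_sum_prod mulr_sumr; apply: ler_sum => v _.
  rewrite mulr_sumr; apply: ler_sum => w _; rewrite mulrA ler_wpM2r ?powR_ge0//.
  exact: word_weight_pow_distortion.
have Z0 k := partition_sum_gt0 t k.
move: up low; rewrite -ler_ln ?posrE ?mulr_gt0// => up.
rewrite -ler_ln ?posrE ?mulr_gt0// => low.
move: up low; rewrite !lnM ?posrE ?mulr_gt0// => up low.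
by rewrite ler_norml; apply/andP; split; lra.
Qed.

Lemma pressure_exists : exists P : R -> R, forall t, 0 <= t <= 1 ->
  forall n, `|ln (partition_sum t n) - n%:R * P t| <= 2 * ln kappa.
Proof.
suff /choice[P PE] : forall t, exists L, 0 <= t <= 1 -> forall n,
    `|ln (partition_sum t n) - n%:R * L| <= 2 * ln kappa by exists P.
(* Outside [0, 1] the pressure gets the dummy value 0. *)
move=> t; have [t01|nt] := pselect (is_true (0 <= t <= 1)); last by exists 0 => /nt.
have [L LE] := quasimorphism_slope (ln_partition_sum_quasimorphism t01).
by exists L.
Qed.

(** The factor p_w is kept in the upper bound because the p_w of fixed length sum to 1, which is
    what makes P(1) negative. *)
Lemma word_weight_geometric : exists a b C, [/\ 0 < b, b <= a, 0 <= C &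
  forall w, - (a * (size w)%:R) <= ln (word_weight x0 w)
    <= ln (word_prob w) + (C - b * (size w)%:R)].
Proof.
have [c [m [/andP[c0 c1] /andP[m0 m1] wE]]] := word_deriv_geometric.
have [pm pm0 pmE] : exists2 q, 0 < q & forall i, - q <= ln (p i).
  pose q := \big[Num.min/(2^-1)]_i p i.
  have q0 : 0 < q by rewrite lt_bigmin ?invr_gt0 ?ltr0n.
  exists (- ln q).
    by rewrite oppr_gt0 ln_lt0// q0 (le_lt_trans (bigmin_le_id _ _ _ _))//; lra.
  by move=> i; rewrite opprK ler_ln ?posrE// bigmin_le_cond.
have lnp w : - (pm * (size w)%:R) <= ln (word_prob w).
  elim: w => [|i w IH]; rewrite /word_prob ?big_nil ?ln1 /= ?mulr0 ?oppr0 ?lexx//.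
  rewrite big_cons lnM ?posrE ?word_prob_gt0// -/(word_prob w).
  by have := pmE i; rewrite -[(size w).+1]addn1 natrD; lra.
have lnm : ln m < 0 by rewrite ln_lt0// m0.
have lnc : ln c < 0 by rewrite ln_lt0// c0.
have C2l : 0 <= ln C2 by rewrite ln_ge0// C2_ge1.
pose b := r * - ln c; have b0 : 0 < b by rewrite mulr_gt0 ?oppr_gt0.
exists (pm + r * - ln m + b), b, (r * ln C2); split=> //.
- by rewrite lerDr addr_ge0 ?(ltW pm0)// mulr_ge0 ?(ltW r_gt0)//; lra.
- by rewrite mulr_ge0 ?(ltW r_gt0).
move=> w; have /andP[w1 w2] := wE w x0.
have h1 : (size w)%:R * ln m <= ln (word_deriv w x0).
  by rewrite mulr_natl -lnXn// ler_ln ?posrE ?exprn_gt0 ?word_deriv_gt0.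
have h2 : ln (word_deriv w x0) <= ln C2 + (size w)%:R * ln c.
  rewrite mulr_natl -lnXn// -lnM ?posrE ?exprn_gt0//.
  by rewrite ler_ln ?posrE ?mulr_gt0 ?exprn_gt0 ?word_deriv_gt0.
rewrite /word_weight lnM ?posrE ?word_prob_gt0 ?powR_gt0 ?word_deriv_gt0// ln_powR.
have h3 := lnp w.
have h5 : r * ((size w)%:R * ln m) <= r * ln (word_deriv w x0) by rewrite ler_pM2l.
have h6 : r * ln (word_deriv w x0) <= r * (ln C2 + (size w)%:R * ln c) by rewrite ler_pM2l.
have h7 : 0 <= b * (size w)%:R by rewrite mulr_ge0// ltW.
rewrite /b in h7 *; apply/andP; split; lra.
Qed.

(** Termwise, q^t = exp((t - s) ln q) q^s. *)
Lemma ln_partition_sum_shift a b n s t : s <= t ->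
  (forall w : n.-tuple 'I_N, a <= ln (word_weight x0 w) <= b) ->
  (t - s) * a <= ln (partition_sum t n) - ln (partition_sum s n) <= (t - s) * b.
Proof.
move=> st wab; have Z0 q := partition_sum_gt0 q n.
have wE w : word_weight x0 w `^ t =
    expR ((t - s) * ln (word_weight x0 w)) * word_weight x0 w `^ s.
  by rewrite /powR gt_eqF ?word_weight_gt0// -expRD -mulrDl subrK.
rewrite lerBrDr lerBlDr; apply/andP; split.
  rewrite -[X in X + _]expRK -lnM ?posrE ?expR_gt0// ler_ln ?posrE ?mulr_gt0 ?expR_gt0//.
  rewrite mulr_sumr; apply: ler_sum => w _; rewrite wE ler_wpM2r ?powR_ge0//.
  by rewrite ler_expR ler_wpM2l ?subr_ge0//; case/andP: (wab w).
rewrite -[X in X + _]expRK -lnM ?posrE ?expR_gt0// ler_ln ?posrE ?mulr_gt0 ?expR_gt0//.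
rewrite mulr_sumr; apply: ler_sum => w _; rewrite wE ler_wpM2r ?powR_ge0//.
by rewrite ler_expR ler_wpM2l ?subr_ge0//; case/andP: (wab w).
Qed.

(** The slope bounds come from the geometric bounds on the weights, the bounded errors disappearing
    after division by n. Z_n(0) = N^n gives P(0) >= 0, and P(0) <= 0 when N = 1. P(1) < 0 because
    q_w <= p_w exp(C - b n) and the p_w sum to 1. *)
Lemma pressure_properties : exists P A B, [/\ 0 < A, 0 < B &
  forall t, 0 <= t <= 1 -> forall n,
    `|ln (partition_sum t n) - n%:R * P t| <= 2 * ln kappa] /\
  [/\ forall s t, 0 <= s -> s <= t -> t <= 1 -> B * (t - s) <= P s - P t <= A * (t - s),
  0 <= P 0, P 1 < 0 & (0 < P 0 -> (1 < N)%N)].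
Proof.
have [P PE] := pressure_exists.
have [a [b [C [b0 ba C0 wE]]]] := word_weight_geometric.
have PE0 := PE 0 (ltac:(by rewrite lexx ler01)).
have PE1 := PE 1 (ltac:(by rewrite lexx ler01)).
have Z0 n : partition_sum 0 n = (N ^ n)%:R.
  rewrite /partition_sum (eq_bigr (fun=> 1)) => [|w _]; last by rewrite powRr0.
  by rewrite sumr_const card_tuple card_ord.
have Npos : (0 < N)%N by have [i _] := ifs_alphabet; exact: leq_ltn_trans (ltn_ord i).
exists P, a, b; split; first by split=> //; exact: lt_le_trans ba.
split=> //.
- move=> s t s0 st t1; have t0 := le_trans s0 st; have s1 := le_trans st t1.
  have shift n := @ln_partition_sum_shift (- (a * n%:R)) (C - b * n%:R) n s t st.
  have {}shift n : (t - s) * - (a * n%:R) <=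
      ln (partition_sum t n) - ln (partition_sum s n) <= (t - s) * (C - b * n%:R).
    apply: shift => w; have := wE w; rewrite size_tuple => /andP[-> h] /=.
    by apply: le_trans h _; rewrite gerDr ln_word_prob_le0.
  have Ps := PE s (ltac:(by rewrite s0)); have Pt := PE t (ltac:(by rewrite t0)).
  apply/andP; split; rewrite -subr_le0.
    apply: (@le0_of_natmul_bounded _ _ (4 * ln kappa + (t - s) * C)) => n.
    have := Ps n; have := Pt n; have := shift n; rewrite !ler_norml.
    by move=> /andP[? ?] /andP[? ?] /andP[? ?]; lra.
  apply: (@le0_of_natmul_bounded _ _ (4 * ln kappa)) => n.
  have := Ps n; have := Pt n; have := shift n; rewrite !ler_norml.
  by move=> /andP[? ?] /andP[? ?] /andP[? ?]; lra.
- rewrite -oppr_le0; apply: (@le0_of_natmul_bounded _ _ (2 * ln kappa)) => n.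
  have := PE0 n; rewrite Z0 ler_norml => /andP[_].
  have : 0 <= ln (N ^ n)%:R :> R by rewrite ln_ge0// ler1n expn_gt0 Npos.
  by rewrite mulrN; lra.
- suff : P 1 + b <= 0 by lra.
  apply: (@le0_of_natmul_bounded _ _ (2 * ln kappa + C)) => n.
  have := PE1 n; rewrite ler_norml => /andP[h _].
  have : ln (partition_sum 1 n) <= C - b * n%:R.
    rewrite -[leRHS]expRK ler_ln ?posrE ?expR_gt0 ?partition_sum_gt0//.
    rewrite -[leRHS]mul1r -[X in X * _](sum_word_prob n) mulr_suml.
    apply: ler_sum => w _; rewrite powRr1 ?(ltW (word_weight_gt0 _ _))//.
    rewrite -[word_prob w]lnK ?posrE ?word_prob_gt0// -expRD.
    rewrite -[leLHS]lnK ?posrE ?word_weight_gt0// ler_expR.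
    by have := wE w; rewrite size_tuple => /andP[].
  by rewrite mulrDr; lra.
move=> P0; rewrite ltnNge; apply/negP => N1.
have NE : N = 1%N by apply/eqP; rewrite eqn_leq N1.
move: P0; apply/negP; rewrite -leNgt.
apply: (@le0_of_natmul_bounded _ _ (2 * ln kappa)) => n.
have := PE0 n; rewrite Z0 NE exp1n ln1 sub0r normrN ler_norml => /andP[_].
exact: le_trans.
Qed.

(** * The transfer operator and its spectral radius *)

Lemma word_weight_cons_pow x i w t : word_weight x (i :: w) `^ t =
  word_weight x w `^ t * (p i * simD (f i) (fw w x) `^ r) `^ t.
Proof.
have D0 := word_deriv_gt0 w x; have P0 := word_prob_gt0 w.
have -> : word_weight x (i :: w) =
    word_weight x w * (p i * simD (f i) (fw w x) `^ r).
  rewrite /word_weight /= powRM ?(ltW D0) ?(ltW (f_pos _ _))//.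
  rewrite /word_prob big_cons; ring.
apply: powRM; first exact/ltW/word_weight_gt0.
by rewrite mulr_ge0 ?powR_ge0// ltW.
Qed.

(** The coefficients of the operator are the one-letter weights to the power s / (r + s). The
    innermost application evaluates them at f_w(x), which prepends a letter to w. *)
Lemma iter_transfer_op s n (Phi : X -> R) x :
  iter n (transfer_op f p s r) Phi x =
  \sum_(w : n.-tuple 'I_N) word_weight x w `^ (s / (r + s)) * Phi (fw w x).
Proof.
elim: n Phi => [|n IH] Phi.
  rewrite (big_pred1 [tuple]) => [|v]; last by rewrite [v]tuple0; exact/esym/eqP.
  by rewrite /word_weight /word_prob big_nil powR1 mulr1 powR1 mul1r.
rewrite iterSr IH; set t := s / (r + s).
rewrite (@big_tuple_cons _ _ n (fun w => word_weight x w `^ t * Phi (fw w x))).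
rewrite exchange_big; apply: eq_bigr => w _.
rewrite /transfer_op -/t [LHS]big_distrr; apply: eq_bigr => i _.
by rewrite word_weight_cons_pow; exact: mulrA.
Qed.

Lemma transfer_op_spectral_radius s L : 0 <= s ->
  (forall n, `|ln (partition_sum (s / (r + s)) n) - n%:R * L| <= 2 * ln kappa) ->
  spectral_radius (transfer_op f p s r) = (expR L)%:E.
Proof.
move=> s0 ZL; set t := s / (r + s) in ZL *.
have rs0 : 0 < r + s by rewrite ltr_pwDl.
have t01 : 0 <= t <= 1.
  by rewrite divr_ge0 ?(ltW rs0)//= ler_pdivrMr// mul1r lerDr ltW.
(* One factor is the bounded error of the pressure, the other the change of base point from x0 to
   x. *)
pose K := expR (2 * ln kappa) * kappa.
have k0 : 0 < kappa by apply: lt_le_trans distortion_const_ge1.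
have ZE n : partition_sum t n <= expR (2 * ln kappa) * expR L ^+ n /\
    expR L ^+ n <= expR (2 * ln kappa) * partition_sum t n.
  have := ZL n; rewrite ler_norml => /andP[h1 h2].
  rewrite -expRM_natl -[partition_sum t n]lnK ?posrE ?partition_sum_gt0//.
  by rewrite -!expRD !ler_expR; split; lra.
apply: (@spectral_radius_growth_rate _ _ _ compactX x0 _ _ _ _ K).
- move=> a b u v; apply/funext => x; rewrite /transfer_op !mulr_sumr -big_split.
  by apply: eq_bigr => i _ /=; ring.
- move=> u v uv x; apply: ler_sum => i _; by rewrite ler_wpM2l ?powR_ge0.
- move=> u cu; apply: continuous_sum => i x; apply: cvgM; last first.
    by apply: (@continuous_comp _ _ _ (f i) u); [exact: ifs_continuous|exact: cu].
  apply: (@continuous_powR_pos R X (fun x => p i * simD (f i) x `^ r)); last first.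
    by move=> y; rewrite mulr_gt0 ?powR_gt0.
  move=> y; apply: cvgM; first exact: cvg_cst.
  apply: (@continuous_powR_pos R X (simD (f i))) => //.
  exact: hoelder_real_continuous.
- exact: expR_gt0.
- by rewrite mulr_ge0 ?expR_ge0 ?(ltW k0).
- move=> n x; rewrite iter_transfer_op.
  have -> : K * expR L ^+ n = kappa * (expR (2 * ln kappa) * expR L ^+ n).
    by rewrite /K mulrCA mulrA.
  apply: (@le_trans _ _ (kappa * partition_sum t n)); last first.
    by rewrite ler_pM2l//; case: (ZE n).
  rewrite mulr_sumr; apply: ler_sum => w _; rewrite /cst mulr1.
  exact: word_weight_pow_distortion.
move=> n x; rewrite iter_transfer_op; apply: le_trans (ZE n).2 _.
rewrite /K -mulrA ler_pM2l ?expR_gt0// mulr_sumr; apply: ler_sum => w _.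
by rewrite /cst mulr1; exact: word_weight_pow_distortion.
Qed.

(** The suffix u is the beginning of an address of a point e of E in G, long enough for f_u(X) to
    lie in G. Two words of equal length then separate at their first differing letter: the common
    prefix cancels by injectivity, and distinct letters map G to disjoint sets. *)
Lemma sosc_disjoint_words (E : set X) : is_attractor f E ->
  strong_open_set_condition f E ->
  exists u : seq 'I_N, forall v w : seq 'I_N, size v = size w -> v != w ->
    forall x y, fw (v ++ u) x != fw (w ++ u) y.
Proof.
move=> [_ _ EE] [G [[_ oG _] [fG disj [e [Ee Ge]]]]].
have [d d0 dG] : exists2 d : R, 0 < d & forall y, mdist e y < d -> G y.
  have : nbhs e G by exact: open_nbhs_nbhs.
  by move=> /metricType_numDomainType.nbhs_mdistP[d /= d0 dG]; exists d.
have [c [c0 c1 cE]] := common_contraction.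
have [D D0 diamD] := compact_diameter compactX.
have [n nE] : exists n, c ^+ n * D < d.
  apply: contrapT => /forallNP h; have : d <= 0; last by rewrite leNgt d0.
  apply: (@le0_of_geometric_bound _ D c d); first by rewrite (ltW c0).
  by move=> n; rewrite mulrC leNgt; apply/negP/(h n).
(* The invariance of E yields addresses of e of every length. *)
have [u [un [z zE]]] : exists u : seq 'I_N, size u = n /\ exists z, fw u z = e.
  elim: n {nE} e Ee {Ge dG} => [|n IH] e Ee; first by exists [::]; split=> //; exists e.
  move: Ee; rewrite EE => -[i _ [e' Ee' fe']].
  have [u [un [z zE]]] := IH e' Ee'.
  by exists (i :: u); rewrite /= un; split=> //; exists z; rewrite zE.
exists u => v w vw vnw x y; rewrite !ifs_word_cat.
have uG x' : G (fw u x').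
  apply: dG; rewrite -zE; apply: le_lt_trans (cE u z x') _; rewrite un.
  by apply: le_lt_trans nE; rewrite ler_pM2l ?exprn_gt0.
have wG w' a : G a -> G (fw w' a).
  by move=> Ga; elim: w' => //= i w' IH; apply: fG; exists i.
move: (fw u x) (fw u y) (uG x) (uG y) => {x y}.
elim: v w vw vnw => [|i v IH] [|j w]//= [vw] vnw a b Ga Gb.
have [ij|ij] := eqVneq i j; last first.
  apply/eqP => fE; have : (f i @` G `&` f j @` G) (f i (fw v a)).
    by split; [exists (fw v a) => //|exists (fw w b)]; [exact: wG|exact: wG|].
  by rewrite disj.
have vw' : v != w by apply: contra vnw => /eqP ->; rewrite ij.
by rewrite ij; apply: contra (IH w vw vw' a b Ga Gb) => /eqP/ifs_injective ->.
Qed.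

(** * Quantization bounds for the self-similar measure *)

Variable mu : probability (borel X) R.
Hypothesis mu_selfsim : self_similar_measure f p mu.

Lemma ifs_integral_words k (u : X -> R) : continuous u -> (forall x, 0 <= u x) ->
  power_integral mu r u = \sum_(w : k.-tuple 'I_N)
    word_prob w * power_integral mu r (u \o fw w).
Proof.
move=> cu u0; apply: power_integral_words => //; first exact: ifs_continuous.
by move=> i; exact: ltW.
Qed.

Lemma quantization_error_upper t L : 0 < t < 1 -> L < 0 ->
  (forall n, `|ln (partition_sum t n) - n%:R * L| <= 2 * ln kappa) ->
  exists2 B, 0 < B & forall n, (0 < n)%N ->
    (quantization_error r mu n <= (B * n%:R `^ (- ((1 - t) / t)))%:E)%E.
Proof.
move=> t01 L0 ZL.
have [D D0 diamD] := compact_diameter compactX.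
have C30 : 0 < C2 ^+ 3 by rewrite exprn_gt0.
(* The Lipschitz constant of f_w is taken as C2^3 D_w(x0): one C2 from the distance estimate, two
   from moving the base point. The threshold [e] compensates this factor, so that the weights sum to
   at most 1/2. *)
pose e := 2^-1 / ((C2 ^+ 3) `^ r) `^ t.
have e0 : 0 < e by rewrite divr_gt0 ?powR_gt0 ?invr_gt0.
(* Negative pressure makes the partition sums tend to 0; if they all exceeded [e], L would be
   nonnegative. *)
have [k kE] : exists k, partition_sum t k <= e.
  apply: contrapT => /forallNP h; have : - L <= 0; last by rewrite leNgt oppr_gt0 L0.
  apply: (@le0_of_natmul_bounded _ _ (2 * ln kappa - ln e)) => n.
  have : ln e <= ln (partition_sum t n).
    by rewrite ler_ln ?posrE ?partition_sum_gt0// leNgt; apply/negP => /ltW/h.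
  by have := ZL n; rewrite ler_norml => /andP[_]; lra.
have lip (w : k.-tuple 'I_N) x y :
    mdist (fw w x) (fw w y) <= C2 ^+ 3 * word_deriv w x0 * mdist x y.
  apply: le_trans (ifs_word_dist_le w x y) _.
  rewrite ler_wpM2r ?mdist_ge0// [C2 ^+ 3]exprS -mulrA ler_pM2l//.
  exact: word_deriv_distortion.
have int_le (u : X -> R) : continuous u -> (forall x, 0 <= u x) ->
    power_integral mu r u <= \sum_(w : k.-tuple 'I_N)
      word_prob w * power_integral mu r (u \o fw w).
  by move=> cu u0; rewrite -(ifs_integral_words k cu u0).
have sum_le : \sum_(w : k.-tuple 'I_N)
    (word_prob w * (C2 ^+ 3 * word_deriv w x0) `^ r) `^ t <= 2^-1.
  rewrite (_ : \sum_w _ = ((C2 ^+ 3) `^ r) `^ t * partition_sum t k).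
    by rewrite mulrC -ler_pdivlMr ?powR_gt0.
  rewrite mulr_sumr; apply: eq_bigr => w _.
  rewrite (powRM r (ltW C30) (ltW (word_deriv_gt0 w x0))) mulrCA.
  by rewrite (powRM t (powR_ge0 _ _) (ltW (word_weight_gt0 x0 w))).
have words_gt0 : (0 < #|{: k.-tuple 'I_N}|)%N.
  by have [i _] := ifs_alphabet; apply/card_gt0P; exists [tuple of nseq k i].
have [B B0 BE] := quantization_upper_bound compactX r_gt0
  (fun w : k.-tuple 'I_N => ifs_word_continuous ifs_continuous (w := w))
  (fun w : k.-tuple 'I_N => word_prob_gt0 w) t01 words_gt0 D0 diamD
  (fun w : k.-tuple 'I_N => mulr_gt0 C30 (word_deriv_gt0 w x0)) lip int_le sum_le.
exists B => // n /BE[s [s0 sn sE]].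
exact: quantization_error_le sE.
Qed.

Lemma quantization_error_lower (E : set X) t L : is_attractor f E ->
  strong_open_set_condition f E -> 0 < t < 1 -> 0 < L -> (1 < N)%N ->
  (forall n, `|ln (partition_sum t n) - n%:R * L| <= 2 * ln kappa) ->
  exists2 b, 0 < b & forall n, (0 < n)%N ->
    ((b * n%:R `^ (- ((1 - t) / t)))%:E <= quantization_error r mu n)%E.
Proof.
move=> attrE sosc t01 L0 N1 ZL; have /andP[t0 t1] := t01.
have [D D0 diamD] := compact_diameter compactX.
have [u uE] := sosc_disjoint_words attrE sosc.
have C30 : 0 < C2 ^+ 3 by rewrite exprn_gt0.
have k0 : 0 < kappa by apply: lt_le_trans distortion_const_ge1.
(* All losses of one step: C2^3 and the factor 2 from the lower Lipschitz constants, the weight of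
   the fixed suffix u, and kappa for moving the base point from f_u(x0) to x0. *)
pose K := ((C2 ^+ 3 * 2)^-1 `^ r) `^ t * (word_weight x0 u `^ t / kappa).
have K0 : 0 < K.
  apply: mulr_gt0; first by rewrite !powR_gt0// invr_gt0 mulr_gt0.
  by rewrite divr_gt0// powR_gt0// word_weight_gt0.
(* Positive pressure makes the partition sums outgrow 1/K; k > 0 guarantees at least two words. *)
have [k [kpos kE]] : exists k, (0 < k)%N /\ 1 <= K * partition_sum t k.
  apply: contrapT => /forallNP h; have : L <= 0; last by rewrite leNgt L0.
  apply: (@le0_of_natmul_bounded _ _ (2 * ln kappa - ln K + L)) => n.
  have hn : K * partition_sum t n.+1 <= 1.
    by rewrite leNgt; apply/negP => /ltW hK; apply: (h n.+1).
  have : ln K + ln (partition_sum t n.+1) <= 0.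
    rewrite -lnM ?posrE ?partition_sum_gt0//; exact: ln_le0.
  have := ZL n.+1; rewrite ler_norml -[n.+1]addn1 natrD => /andP[].
  by lra.
have lE (v : k.-tuple 'I_N) x y : word_deriv (v ++ u) x0 / C2 ^+ 3 * mdist x y <=
    mdist (fw (v ++ u) x) (fw (v ++ u) y).
  apply: le_trans (ifs_word_dist_ge _ x y); rewrite ler_wpM2r ?mdist_ge0//.
  rewrite ler_pdivrMr// exprS [_ / C2 * _]mulrA divfK ?gt_eqF// mulrC.
  exact: word_deriv_distortion.
have l01 (v : k.-tuple 'I_N) : 0 < word_deriv (v ++ u) x0 / C2 ^+ 3 <= 1.
  rewrite divr_gt0 ?word_deriv_gt0//=.
  have [y yx _] := perfect_approx perfectX x0 (@ltr01 R).
  have [c [c0 c1 cE]] := common_contraction.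
  have := le_trans (lE v y x0) (cE (v ++ u) y x0).
  rewrite ler_pM2r ?mdist_gt0// => h; apply: le_trans h _.
  by rewrite exprn_ile1// ltW.
have disj (v w : k.-tuple 'I_N) x y : v != w -> fw (v ++ u) x != fw (w ++ u) y.
  move=> vw; apply: uE; first by rewrite !size_tuple.
  by apply: contra vw => /eqP/val_inj ->.
have int_le (h : X -> R) : continuous h -> (forall x, 0 <= h x) ->
    \sum_(v : k.-tuple 'I_N) word_prob (v ++ u) *
      power_integral mu r (h \o fw (v ++ u)) <= power_integral mu r h.
  (* Among the words of length k + |u| only those ending in u are kept; the other terms are
     nonnegative. *)
  move=> ch h0; rewrite (ifs_integral_words (k + size u) ch h0).
  rewrite (big_tuple_cat _ _ (fun w => word_prob w * power_integral mu r (h \o fw w))).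
  apply: ler_sum => v _; rewrite (bigD1 (in_tuple u))//= lerDl.
  by apply: sumr_ge0 => w _; rewrite mulr_ge0 ?power_integral_ge0 ?(ltW (word_prob_gt0 _)).
have sum_ge : 1 <= \sum_(v : k.-tuple 'I_N)
    (word_prob (v ++ u) * (word_deriv (v ++ u) x0 / C2 ^+ 3 / 2) `^ r) `^ t.
  apply: (le_trans kE); rewrite mulr_sumr; apply: ler_sum => v _.
  have -> : word_prob (v ++ u) * (word_deriv (v ++ u) x0 / C2 ^+ 3 / 2) `^ r =
      (C2 ^+ 3 * 2)^-1 `^ r * word_weight x0 (v ++ u).
    have c0 : 0 <= (C2 ^+ 3 * 2)^-1 by rewrite invr_ge0 mulr_ge0 ?(ltW C30).
    rewrite -mulrA -invfM (powRM r (ltW (word_deriv_gt0 (v ++ u) x0)) c0).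
    by rewrite /word_weight mulrA [RHS]mulrC.
  rewrite (powRM t (powR_ge0 _ _) (ltW (word_weight_gt0 x0 (v ++ u)))) /K -!mulrA.
  rewrite ler_pM2l ?powR_gt0 ?invr_gt0 ?mulr_gt0//.
  rewrite word_weight_cat.
  rewrite (powRM t (ltW (word_weight_gt0 _ _)) (ltW (word_weight_gt0 _ _))).
  rewrite [leRHS]mulrC ler_pM2l ?powR_gt0 ?word_weight_gt0//.
  rewrite ler_pdivrMl//; apply: word_weight_pow_distortion.
  by rewrite (ltW t0) (ltW t1).
have words_gt1 : (1 < #|{: k.-tuple 'I_N}|)%N.
  by rewrite card_tuple card_ord -(exp1n k) ltn_exp2r.
have [d [b [d0 b0 bE]]] := quantization_lower_bound compactX r_gt0
  (fun v : k.-tuple 'I_N => ifs_word_continuous ifs_continuous (w := v ++ u))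
  (fun v : k.-tuple 'I_N => word_prob_gt0 (v ++ u)) t01 words_gt1 l01 lE disj
  int_le sum_ge.
exists b => // n n0; apply: (quantization_error_ge compactX r_gt0 D0 diamD _ d0).
by move=> s; exact: bE.
Qed.

(** The map s -> s / (r + s) is strictly increasing from [0, oo) into [0, 1), and P is strictly
    decreasing, so spectral radius 1 singles out the s that is sent to the zero t of P. Values of s
    above and below it give negative and positive pressure, hence the two power bounds. *)
Lemma ifs_quantization_dimension (E : set X) : is_attractor f E ->
  strong_open_set_condition f E ->
  exists sg : R,
    [/\ 0 <= sg,
        spectral_radius (transfer_op f p sg r) = 1%E,
        forall s : R, 0 <= s ->
          spectral_radius (transfer_op f p s r) = 1%E -> s = sg
      & has_quantization_dim r mu sg].
Proof.
move=> attrE sosc.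
have [P [A [B [[A0 B0 PE] [PAB P0 P1 PN]]]]] := pressure_properties.
have [t [t0 t1 Pt]] := bilipschitz_decreasing_root A0 B0 PAB P0 P1.
have t1' : 0 < 1 - t by rewrite subr_gt0.
(* The solution of sg / (r + sg) = t; it is 0 when t = 0. *)
pose sg := r * t / (1 - t).
have sg0 : 0 <= sg by rewrite divr_ge0 ?mulr_ge0 ?(ltW r_gt0) ?(ltW t1').
have tau01 s : 0 <= s -> 0 <= s / (r + s) < 1.
  move=> s0; have rs : 0 < r + s by rewrite ltr_pwDl.
  by rewrite divr_ge0 ?(ltW rs)//= ltr_pdivrMr// mul1r ltrDr.
have tauE : sg / (r + sg) = t.
  rewrite /sg; field; apply/andP; split; first by rewrite gt_eqF.
  by rewrite (_ : _ + _ = r) ?gt_eqF//; ring.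
have sgE s : 0 <= s -> s = r * (s / (r + s)) / (1 - s / (r + s)).
  move=> s0; field; apply/andP; split; first by rewrite gt_eqF// ltr_pwDl.
  by rewrite (_ : _ - _ = r) ?gt_eqF//; ring.
(* This turns the exponent of the allocation bounds into the exponent r / s of the logarithmic
   limit. *)
have alE s : 0 < s -> (1 - s / (r + s)) / (s / (r + s)) = r / s.
  move=> s0; field; apply/andP; split; by rewrite gt_eqF// addr_gt0.
have tau_mono s s' : 0 <= s -> s < s' -> s / (r + s) < s' / (r + s').
  move=> s0 ss'; have s'0 : 0 <= s' by rewrite ltW// (le_lt_trans s0).
  rewrite ltr_pdivrMr ?ltr_pwDl// mulrAC ltr_pdivlMr ?ltr_pwDl//.
  have : r * s < r * s' by rewrite ltr_pM2l.
  lra.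
have spr s : 0 <= s ->
    spectral_radius (transfer_op f p s r) = (expR (P (s / (r + s))))%:E.
  move=> s0; apply: transfer_op_spectral_radius => // n; apply: PE.
  by have /andP[-> /ltW ->] := tau01 s s0.
have Pdecr s s' : 0 <= s -> s < s' -> s' <= 1 -> P s' < P s.
  move=> s0 ss' s'1; have /andP[h _] := PAB s s' s0 (ltW ss') s'1.
  by rewrite -subr_gt0; apply: lt_le_trans h; rewrite mulr_gt0// subr_gt0.
exists sg; split=> //.
- by rewrite spr// tauE Pt expR0.
- move=> s s0; rewrite spr// => -[] /(congr1 (@ln R)); rewrite expRK ln1 => Ps.
  have /andP[q0 q1] := tau01 s s0; rewrite (sgE s s0) /sg.
  have [lt|lt|<-//] := ltgtP (s / (r + s)) t.
    by have := Pdecr _ _ q0 lt (ltW t1); rewrite Ps Pt ltxx.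
  by have := Pdecr _ _ t0 lt (ltW q1); rewrite Ps Pt ltxx.
apply: log_ratio_cvg_of_power_bounds => //; first exact: quantization_error_ge0.
  move=> s sgs; have s0 : 0 < s by exact: le_lt_trans sgs.
  have h := tau_mono _ _ sg0 sgs; rewrite tauE in h.
  have /andP[q0 q1] := tau01 s (ltW s0).
  have q0' : 0 < s / (r + s) by exact: le_lt_trans h.
  rewrite -(alE s s0); apply: (@quantization_error_upper _ (P (s / (r + s)))).
  - by rewrite q0'.
  - by rewrite -Pt; apply: Pdecr => //; exact: ltW.
  by apply: PE; rewrite q0 ltW.
move=> s s0 ssg; have h := tau_mono _ _ (ltW s0) ssg; rewrite tauE in h.
have /andP[q0 q1] := tau01 s (ltW s0).
have q0' : 0 < s / (r + s) by rewrite divr_gt0 ?addr_gt0.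
have Ps : 0 < P (s / (r + s)) by rewrite -Pt; apply: Pdecr => //; exact: ltW.
rewrite -(alE s s0); apply: (@quantization_error_lower E _ (P (s / (r + s)))) => //.
- by rewrite q0'.
(* Positive pressure at a positive exponent forces P(0) > 0, hence at least two maps. *)
- by apply: PN; apply: lt_trans Ps _; apply: Pdecr => //; exact: ltW.
by apply: PE; rewrite q0 ltW.
Qed.

End IteratedFunctionSystem.

Theorem theorem3p1 (R : realType) (X : pointedMetricType R)
  (hcompact : compact [set: X])
  (hperfect : perfect_set [set: X])
  (N : nat) (f : 'I_N -> X -> X)
  (hcontr : forall i, contractive (f i))
  (hsim : forall i, inf_similitude (f i))
  (hpos : forall i x, 0 < simD (f i) x)
  (hhoelder : forall i, hoelder_continuous (simD (f i)))
  (C2 : R) (hC2 : 0 < C2)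
  (hdist : forall w : seq 'I_N, w != [::] -> forall x y : X, x != y ->
     simD (ifs_word f w) x / C2
       <= mdist (ifs_word f w x) (ifs_word f w y) / mdist x y
       <= C2 * simD (ifs_word f w) x)
  (p : 'I_N -> R) (hp : forall i, 0 < p i) (hp1 : \sum_(i < N) p i = 1)
  (mu : probability (borel X) R) (hmu : self_similar_measure f p mu)
  (E : set X) (hE : is_attractor f E)
  (hsosc : strong_open_set_condition f E)
  (r : R) (hr : 0 < r) :
  exists sigma : R,
    [/\ 0 <= sigma,
        spectral_radius (transfer_op f p sigma r) = 1%E,
        forall s : R, 0 <= s ->
          spectral_radius (transfer_op f p s r) = 1%E -> s = sigma
      & has_quantization_dim r mu sigma].
Proof.
exact: (@ifs_quantization_dimension R X hcompact hperfect N f hcontr hsim hpos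
  hhoelder C2 hC2 hdist p hp hp1 r hr mu hmu E hE hsosc).
Qed.
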